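(* Let $(H_n)_n$ be an infinite sequence of local Hamiltonians, $H_n$ acting on $n$ spins, whose interaction graphs all have maximum degree at most $\mathfrak{d}$, where $\mathfrak{d}\ge1$ is independent of $n$, and let $|\Phi\rangle=\bigotimes_{i=1}^n|\phi\rangle_i$ be product states. Let $t_L^*=1/[2e^2\mathfrak{d}(\mathfrak{d}+1)]$, let $g_n(t)=\log\langle\Phi|e^{-itH_n}|\Phi\rangle$, and let $$G(t)=\lim_{n\to\infty}\frac{g_n(t)}{n},$$ the limit being assumed to exist for all real $t$ with $|t|<t_L^*$. Then $G(t)$ is analytic for $|t|<t_L^*$, and thus dynamical phase transitions (points where $G$ is nonanalytic) can occur only at times $|t|\ge t_L^*$.
   Context: For each $n$, $V_n$ is a set of $n$ spins, each carrying a Hilbert space of a fixed dimension $d$, and the total Hilbert space is their tensor product. A subsystem is a subset $X\subseteq V_n$; the support of an operator is the smallest subsystem on which it acts nontrivially. $H_n=\sum_{X\in S_n}\lambda_Xh_X$, where $S_n$ is a set of subsystems with $|X|\le k$ for all $X\in S_n$ ($k$ independent of $n$), $\lambda_X\in\mathbb{R}$, $|\lambda_X|\le1$, and $h_X$ is Hermitian with support $X$ and operator norm $1$. The interaction graph of $H_n$ is the simple graph with vertex set $S_n$ in which two distinct $X,Y$ are joined by an edge iff $X\cap Y\ne\emptyset$. For $|t|<t_L^*$, $\langle\Phi|e^{-itH_n}|\Phi\rangle$ is nonzero, and $\log$ in $g_n$ denotes the analytic branch in $t$ with $g_n(0)=0$. A dynamical phase transition occurs at a time at which $G$ is nonanalytic.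 *)

(* Defs.v *)
(* MathComp with MathComp-Analysis; the complex numbers are R[i]. *)
From HB Require Import structures.
From mathcomp Require Import all_boot all_order all_algebra.
From mathcomp Require Import all_classical all_reals all_analysis.
From mathcomp Require Export complex.
Import Order.TTheory GRing.Theory Num.Theory.
Import numFieldNormedType.Exports.

Set Implicit Arguments.
Unset Strict Implicit.
Unset Printing Implicit Defensive.

Local Open Scope classical_set_scope.
Local Open Scope ring_scope.
Local Open Scope complex_scope.
Local Open Scope sesquilinear_scope.

(* The norm topology of R[i], which the library only attaches to R[i]^o. *)
HB.instance Definition _ (R : realType) := NormedModule.copy R[i] R[i]^o.

Section ComplexAnalysis.
Variable R : realType.

Definition cexp (z : R[i]) : R[i] :=
  let: x +i* y := z in (expR x)%:C * (cos y +i* sin y).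

(* Real analyticity of a complex-valued function of a real variable: f is the
   sum of a power series centred at t on a neighbourhood of t. *)
Definition analytic_at (f : R -> R[i]) (t : R) : Prop :=
  exists (a : nat -> R[i]) (r : R), 0 < r /\
    forall s : R, `|s - t| < r ->
      series (fun k => a k * ((s - t)%:C) ^+ k) @ \oo --> f s.

Definition is_log_branch (r : R) (f g : R -> R[i]) : Prop :=
  [/\ g 0 = 0,
      forall t : R, `|t| < r -> analytic_at g t
    & forall t : R, `|t| < r -> cexp (g t) = f t].

(* The values of log_branch r f are meaningful on |t| < r only, where a branch
   is unique; if f has no such branch, log_branch r f is the constant 0. *)
Definition log_branch (r : R) (f : R -> R[i]) : R -> R[i] :=
  xget (fun=> 0) [set g | is_log_branch r f g].

Definition expmx N (A : 'M[R[i]]_N) : 'M[R[i]]_N :=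
  lim (series (fun k => (k`!%:R)^-1 *: A ^+ k) @ \oo).

Definition l2norm N (v : 'cV[R[i]]_N) : R :=
  Num.sqrt (\sum_i (complex.Re `|v i 0|) ^+ 2).

Definition opnorm N (A : 'M[R[i]]_N) : R :=
  sup [set l2norm (A *m v) | v in [set v | l2norm v <= 1]].

End ComplexAnalysis.

Section Spins.
Variables (R : realType) (d n : nat).

(* Basis states of n spins of local dimension d. The total Hilbert space is
   C^(d^n), its coordinates being indexed by the configurations via enum_rank. *)
Definition config := {ffun 'I_n -> 'I_d}.

Definition hdim := #|{: config}|.

Definition operator := 'M[R[i]]_hdim.

Definition restrict (X : {set 'I_n}) (s : config) :
    {ffun {i : 'I_n | i \in X} -> 'I_d} := [ffun i => s (val i)].

(* A is B tensored with the identity on the complement of X. *)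
Definition acts_on (X : {set 'I_n}) (A : operator) : Prop :=
  exists B : {ffun {i : 'I_n | i \in X} -> 'I_d} ->
             {ffun {i : 'I_n | i \in X} -> 'I_d} -> R[i],
    forall s t : config, A (enum_rank s) (enum_rank t) =
      B (restrict X s) (restrict X t)
      * (restrict (~: X) s == restrict (~: X) t)%:R.

Definition has_support (A : operator) (X : {set 'I_n}) : Prop :=
  acts_on X A /\ forall Y : {set 'I_n}, acts_on Y A -> X \subset Y.

(* The values of ham_coef and ham_op outside ham_terms are irrelevant. *)
Record hamiltonian := Hamiltonian {
  ham_terms : {set {set 'I_n}} ;
  ham_coef : {set 'I_n} -> R ;
  ham_op : {set 'I_n} -> operator
}.

Definition is_local (k : nat) (H : hamiltonian) : Prop :=
  forall X : {set 'I_n}, X \in ham_terms H ->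
    [/\ (#|X| <= k)%N, `|ham_coef H X| <= 1,
        ham_op H X \is hermsymmx, has_support (ham_op H X) X
      & opnorm (ham_op H X) = 1].

Definition ham_mx (H : hamiltonian) : operator :=
  \sum_(X in ham_terms H) (ham_coef H X)%:C *: ham_op H X.

Definition interaction_graph (H : hamiltonian) : rel {set 'I_n} :=
  fun X Y => [&& X \in ham_terms H, Y \in ham_terms H, X != Y
               & ~~ [disjoint X & Y]].

Definition max_degree (H : hamiltonian) : nat :=
  \max_(X in ham_terms H) #|[pred Y | interaction_graph H X Y]|.

Definition product_state (phi : 'I_n -> 'cV[R[i]]_d) : 'cV[R[i]]_hdim :=
  \col_a \prod_(i < n) phi i ((enum_val a : config) i) 0.

Definition loschmidt_amplitude (H : hamiltonian) (phi : 'I_n -> 'cV[R[i]]_d)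
    (t : R) : R[i] :=
  ((product_state phi) ^t* *m expmx (- ('i * t%:C) *: ham_mx H)
   *m product_state phi) 0 0.

End Spins.

Definition loschmidt_time (R : realType) (deg : nat) : R :=
  1 / (2 * expR 1 ^+ 2 * deg%:R * (deg.+1)%:R).

Definition dynamical_phase_transition (R : realType) (G : R -> R[i]) (t : R) :
  Prop := ~ analytic_at G t.

(* Main.v *)
(* The amplitude of a set U of interaction terms is a power series Z(U) in t.
   Let Y(X; U) be the part of the Dyson series of X u U coming from the words
   in which every term of X occurs, so that Z(U) = Y(0; U) and
   Y(X; u + U) = Y(X; U) + Y(u + X; U).  If no term of X meets a term of U,
   then Y(X; U) = Y(X; 0) Z(U), because the state is a product state.  With the
   norm |a| = sum |a_m| r^m on power series, adding the neighbours of X in U one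
   at a time yields, for q = e^r - 1,
     |Y(X; U) / Z(U)| <= q^#X rho^(number of neighbours of X in U),
   provided q rho^deg <= eps and (1 + eps) / (1 - eps) <= rho; in particular
   Z(u + U) / Z(U) = 1 + b with b(0) = 0 and |b| <= eps.  Multiplying these
   ratios, the m-th Taylor coefficient of log Z(U) is O(#U r^-m), uniformly in
   the Hamiltonian, and r = t_L is admissible.  Since there are O(n) terms, the
   coefficients of g_n / n are bounded by K t_L^-m uniformly in n, so pointwise
   convergence on the real interval makes them converge, and the limit is the
   sum of a power series of radius at least t_L. *)
Require Import Defs.
From mathcomp Require Import all_boot all_order all_algebra.
From mathcomp Require Import zify ring lra.
From mathcomp Require Import all_classical all_reals all_analysis.
Import Order.TTheory GRing.Theory Num.Theory.
Import numFieldNormedType.Exports.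

Set Implicit Arguments.
Unset Strict Implicit.
Unset Printing Implicit Defensive.

Local Open Scope classical_set_scope.
Local Open Scope ring_scope.
Local Open Scope complex_scope.

(** * Words in noncommuting letters *)

(** The obstacle is that the terms do not commute, so Z(U) has no expansion over unordered clusters.
    Dyson words in which every letter of X occurs take the place of clusters, and terms of U are
    commuted out only when none of them meets X. The value q = e^r - 1 is the exponential generating
    function of nonempty sets of positions: each compulsory letter occupies such a set. Division by
    Z(U) makes sense because its constant term is 1 for every U, and the bound has to be proved for
    all X at once because absorbing a neighbour enlarges X. All series are cut at an arbitrary
    degree M, so that norms are finite sums and inverses are polynomials; the bounds do not depend
    on M, and the truncations are glued afterwards. A branch of the logarithm is given on a real
    interval only, hence the detour through t Z'/Z: it yields candidate coefficients without
    composing with log, and every branch is then identified with their series by comparing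
    derivatives. *)

Lemma sum_pascal (V : nmodType) (f : nat -> nat -> V) m :
  \sum_(j < m.+2) f j (m.+1 - j)%N *+ 'C(m.+1, j) =
  \sum_(j < m.+1) (f j.+1 (m - j)%N + f j (m - j).+1) *+ 'C(m, j).
Proof.
under [RHS]eq_bigr do rewrite mulrnDl.
rewrite big_split /= big_ord_recl /= subn0 bin0 mulr1n.
under eq_bigr => i _ do rewrite /bump /= add1n subSS binS mulrnDr.
rewrite big_split /= addrA addrC; congr (_ + _).
rewrite big_ord_recr /= bin_small // mulr0n addr0.
rewrite [RHS]big_ord_recl /= subn0 bin0 mulr1n; congr (_ + _).
by apply: eq_bigr => i _; rewrite /bump /= add1n subnSK.
Qed.

Section Words.
Import boot.fintype boot.finset.
Local Open Scope bool_scope.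
Local Open Scope ring_scope.
Variables (T : finType) (A : pzSemiRingType) (h : T -> A).
Implicit Types (X U V : {set T}) (m : nat).

(* The sum of the words of length m over X :|: U in which every letter of X
   occurs; X and U are meant to be disjoint. *)
Fixpoint words m X U : A :=
  if m is m'.+1 then
    \sum_(u in U) h u * words m' X U
    + \sum_(a in X) h a * words m' (X :\ a) (a |: U)
  else (X == set0)%:R.

Lemma words_set0 m U : words m set0 U = (\sum_(u in U) h u) ^+ m.
Proof.
elim: m => [|m IH] /=; first by rewrite eqxx.
by rewrite [X in _ + X]big_set0 addr0 IH exprS mulr_suml.
Qed.

(** A word either avoids u or contains it, and in the second case u is one more compulsory
    letter. *)
Lemma words_split m X U u : u \notin X -> u \notin U ->
  words m X (u |: U) = words m X U + words m (u |: X) U.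
Proof.
elim: m X U => [|m IH] X U uX uU /=.
  have /set0Pn/negbTE -> : exists x, x \in u |: X by exists u; rewrite setU11.
  by rewrite addr0.
rewrite !big_setU1 //= setU1K // IH //.
have -> : \sum_(a in X) h a * words m (X :\ a) (a |: (u |: U)) =
    \sum_(a in X) h a * words m (X :\ a) (a |: U) +
    \sum_(a in X) h a * words m ((u |: X) :\ a) (a |: U).
  rewrite -big_split; apply: eq_bigr => a aX.
  have ua : u != a by apply: contraNneq uX => ->.
  rewrite setUCA IH ?mulrDr ?in_setD1 ?in_setU1 ?negb_or ?negb_and ?ua ?uX
    ?orbT //.
  congr (_ + _ * words _ _ _); apply/setP => x; rewrite !inE.
  by case: (x =P u) => [->|] //=; rewrite ?ua.
rewrite -!mulr_suml; set P := h u * _; set c1 := \sum_(_ in X) _.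
rewrite mulrDr (addrC P) -!addrA; congr (_ + _).
by rewrite [RHS]addrCA; congr (_ + _); rewrite [RHS]addrCA.
Qed.

Lemma comm_words m X U x :
  (forall y, y \in X :|: U -> GRing.comm x (h y)) -> GRing.comm x (words m X U).
Proof.
elim: m X U => [|m IH] X U cx /=; first exact: commr_nat.
apply: commrD; apply: commr_sum => a aS; apply: commrM.
- by apply: cx; rewrite inE aS orbT.
- exact: IH.
- by apply: cx; rewrite inE aS.
- apply: IH => y; rewrite !inE => H; apply: cx; rewrite inE.
  by case: (y =P a) H => [->|] /=; rewrite ?aS.
Qed.

(** The letters of V slide to the right past all the others, so a word is fixed by its two subwords
    and by the j positions that carry letters of X and U. After division by m! this becomes a Cauchy
    product. *)
Lemma words_binomial m X U V : [disjoint U & V] -> [disjoint X & V] ->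
  (forall x y, x \in X :|: U -> y \in V -> GRing.comm (h x) (h y)) ->
  words m X (U :|: V) =
  \sum_(j < m.+1) words j X U * (\sum_(v in V) h v) ^+ (m - j) *+ 'C(m, j).
Proof.
set HV := \sum_(v in V) h v.
elim: m X U => [|m IH] X U dUV dXV cXV.
  by rewrite big_ord1 /= mulr1 bin0 mulr1n.
rewrite [LHS]/= (eq_bigl [predU U & V]) => [|i]; last by rewrite !inE.
rewrite bigU //= -!mulr_suml IH //.
have -> : \sum_(a in X) h a * words m (X :\ a) (a |: (U :|: V)) =
  \sum_(a in X) \sum_(j < m.+1)
    h a * words j (X :\ a) (a |: U) * HV ^+ (m - j) *+ 'C(m, j).
  apply: eq_bigr => a aX; rewrite setUA IH.
  - by rewrite mulr_sumr; apply: eq_bigr => j _; rewrite mulrnAr mulrA.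
  - rewrite disjoints_subset subUset sub1set inE -disjoints_subset dUV andbT.
    by rewrite (disjointFr dXV aX).
  - by apply: disjointWl dXV; apply: subsetDl.
  - move=> x y; rewrite !inE => H yV; apply: cXV => //; rewrite inE.
    by case: (x =P a) H => [->|] /=; rewrite ?aX.
(* Pascal's rule separates the words whose first letter lies in V from the others. *)
rewrite exchange_big /= (sum_pascal (fun i j => words i X U * HV ^+ j)).
rewrite !mulr_sumr -!big_split /=; apply: eq_bigr => j _.
rewrite !mulrnAr sumrMnl -!mulrnDl; congr (_ *+ _).
rewrite -/HV -mulr_suml -mulr_suml mulrDl !mulrA addrAC; congr (_ + _).
have -> : HV * words j X U = words j X U * HV.
  apply: (@comm_words j X U HV) => y yXU.
  by apply/commr_sym/commr_sum => v vV; exact: cXV.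
by rewrite exprS mulrA.
Qed.

End Words.

(* The number of words counted by [words m X U] with #|X| = a and #|U| = u. *)
Fixpoint nb_words (m a u : nat) : nat :=
  if m is m'.+1 then (u * nb_words m' a u + a * nb_words m' a.-1 u.+1)%N
  else a == 0%N.

Lemma nb_words0 m u : nb_words m 0 u = (u ^ m)%N.
Proof. by elim: m => //= m ->; rewrite mul0n addn0 expnS. Qed.

(** The counting form of [words_split]: a compulsory letter is a difference of two counts with
    optional letters only in its place. *)
Lemma nb_words_split m a u :
  (nb_words m a.+1 u + nb_words m a u)%N = nb_words m a u.+1.
Proof.
elim: m a u => //= m IH [|a] u /=; first by have := IH 0%N u; nia.
by have := IH a.+1 u; have := IH a u.+1; nia.
Qed.

(** * Truncated power series and the cluster bound *)

Section TruncatedSeries.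
Import boot.fintype boot.finset.
Local Open Scope bool_scope.
Local Open Scope ring_scope.
Variables (C : numFieldType) (r : C) (M : nat).
Implicit Types p q : {poly C}.

(** Congruence modulo 'X^M: polynomials stand for power series cut at degree M. *)
Definition eqX p q := forall i, (i < M)%N -> p`_i = q`_i.

Lemma eqX_refl p : eqX p p. Proof. by []. Qed.

Lemma eqX_trans q p s : eqX p q -> eqX q s -> eqX p s.
Proof. by move=> pq qs i iM; rewrite pq // qs. Qed.

Lemma eqX_sym p q : eqX p q -> eqX q p.
Proof. by move=> pq i iM; rewrite pq. Qed.

Lemma eqXD p p' q q' : eqX p p' -> eqX q q' -> eqX (p + q) (p' + q').
Proof. by move=> pp qq i iM; rewrite !coefD pp // qq. Qed.

Lemma eqXM p p' q q' : eqX p p' -> eqX q q' -> eqX (p * q) (p' * q').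
Proof.
move=> pp qq i iM; rewrite !coefM; apply: eq_bigr => j _.
by rewrite pp ?qq //; have := ltn_ord j; lia.
Qed.

(** The polynomial b = 1 - p is divisible by 'X, so the finite geometric sum in b inverts p up to
    b^M, which vanishes modulo 'X^M. *)
Lemma eqX_inv p : p`_0 = 1 -> exists q, eqX (p * q) 1.
Proof.
move=> p0; pose b := 1 - p; exists (\sum_(k < M) b ^+ k).
have -> : p * \sum_(k < M) b ^+ k = 1 - b ^+ M.
  by rewrite -opprB subrX1 -mulNr opprB /b opprB addrCA subrr addr0.
have [s ->] : exists s, b = s * 'X.
  have : root b 0 by rewrite /root horner_coef0 coefB p0 coef1 subrr.
  by case/factor_theorem => s ->; exists s; rewrite subr0.
by move=> i iM; rewrite exprMn coefB coefMXn iM subr0.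
Qed.

Hypothesis r_ge0 : 0 <= r.

Definition wnorm p := \sum_(i < M) `|p`_i| * r ^+ i.

Lemma wnorm_ge0 p : 0 <= wnorm p.
Proof. by apply: sumr_ge0 => i _; rewrite mulr_ge0 ?exprn_ge0. Qed.

Lemma eqX_wnorm p q : eqX p q -> wnorm p = wnorm q.
Proof. by move=> pq; apply: eq_bigr => i _; rewrite pq. Qed.

Lemma wnormD p q : wnorm (p + q) <= wnorm p + wnorm q.
Proof.
rewrite -big_split; apply: ler_sum => i _ /=; rewrite -mulrDl coefD.
by rewrite ler_wpM2r ?exprn_ge0 ?ler_normD.
Qed.

Lemma wnorm1_le : wnorm 1 <= 1.
Proof.
rewrite /wnorm; case: M => [|n]; first by rewrite big_ord0 ler01.
rewrite big_ord_recl coef1 normr1 mul1r expr0 big1 ?addr0 // => i _.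
by rewrite coef1 normr0 mul0r.
Qed.

Lemma norm_coefM_le p q m :
  `|(p * q)`_m| * r ^+ m <=
  \sum_(j < m.+1) (`|p`_j| * r ^+ j) * (`|q`_(m - j)| * r ^+ (m - j)).
Proof.
rewrite coefM; apply: le_trans
  (_ : (\sum_(j < m.+1) `|p`_j * q`_(m - j)|) * r ^+ m <= _).
  by rewrite ler_wpM2r ?exprn_ge0 ?ler_norm_sum.
rewrite mulr_suml ler_sum // => j _; rewrite normrM mulrACA -exprD subnKC //.
by rewrite -ltnS.
Qed.

Lemma wnormM p q : wnorm (p * q) <= wnorm p * wnorm q.
Proof.
pose a j := `|p`_j| * r ^+ j; pose b j := `|q`_j| * r ^+ j.
have a0 j : 0 <= a j by rewrite mulr_ge0 ?exprn_ge0.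
have b0 j : 0 <= b j by rewrite mulr_ge0 ?exprn_ge0.
apply: le_trans (_ : \sum_(m < M) \sum_(j < m.+1) a j * b (m - j)%N <= _).
  by apply: ler_sum => m _; exact: norm_coefM_le.
have -> : \sum_(m < M) \sum_(j < m.+1) a j * b (m - j)%N =
    \sum_(j < M) \sum_(m < M | (j <= m)%N) a j * b (m - j)%N.
  rewrite [RHS](exchange_big_dep xpredT) //=; apply: eq_bigr => m _.
  rewrite (big_ord_widen_cond M xpredT (fun j => a j * b (m - j)%N)) //=.
rewrite mulr_suml ler_sum // => j _; rewrite -mulr_sumr ler_wpM2l //.
rewrite -(big_mkord (fun m => (j <= m)%N) (fun m => b (m - j)%N)).
rewrite (big_cat_nat (n := j)) //=; last exact: ltnW.
rewrite big_nat_cond big_pred0 ?add0r; last first.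
  by move=> i; apply/negbTE; lia.
rewrite -{1}[val j]add0n big_addn big_mkcond /= -/b.
rewrite /wnorm -(big_mkord xpredT b) [leRHS](big_cat_nat (n := M - j)) //=; last lia.
rewrite ler_wpDr ?sumr_ge0 // ler_sum // => i _; rewrite addnK.
by case: ifP.
Qed.

(** The congruence gives q = 1 - p q, hence |q| <= 1 + e |q|; the truncated norm is a finite number,
    so this can be solved for |q|. *)
Lemma wnorm_inv_le p q e : eqX ((1 + p) * q) 1 -> wnorm p <= e -> e < 1 ->
  wnorm q <= (1 - e)^-1.
Proof.
move=> pq pe e1; rewrite -div1r ler_pdivlMr ?subr_gt0 //.
have qE : eqX q (1 + - (p * q)).
  by move=> i iM; rewrite !coefD -(pq i) // mulrDl mul1r coefD coefN addrK.
have : wnorm q <= 1 + e * wnorm q.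
  rewrite {1}(eqX_wnorm qE); apply: le_trans (wnormD _ _) _.
  rewrite lerD ?wnorm1_le //.
  have -> : wnorm (- (p * q)) = wnorm (p * q).
    by apply: eq_bigr => i _; rewrite coefN normrN.
  by apply: le_trans (wnormM _ _) _; rewrite ler_wpM2r ?wnorm_ge0.
by rewrite mulrBr mulr1 [_ * e]mulrC lerBlDr.
Qed.

(** The operator 'X d/d'X multiplies the j-th coefficient by j <= m, so only a factor m is lost and
    the radius r is kept. *)
Lemma norm_coef_dlog_le p q m : (m < M)%N ->
  `|(('X * p^`()) * q)`_m| * r ^+ m <= m%:R * (wnorm p * wnorm q).
Proof.
move=> mM; apply: le_trans (norm_coefM_le _ _ _) _.
have xd j : ('X * p^`())`_j = p`_j *+ j.
  by rewrite mulrC coefMX; case: j => //= j; rewrite coef_deriv.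
apply: le_trans (_ : \sum_(j < m.+1) m%:R * ((`|p`_j| * r ^+ j) * wnorm q) <= _).
  apply: ler_sum => j _; rewrite xd normrMn -[_ *+ j]mulr_natl -!mulrA.
  have jm : (j <= m)%N by rewrite -ltnS.
  apply: ler_pM => //; first by rewrite !mulr_ge0 ?exprn_ge0.
    by rewrite ler_nat.
  rewrite !ler_wpM2l ?exprn_ge0 // /wnorm.
  have mj : (m - j < M)%N by lia.
  rewrite (bigD1 (Ordinal mj)) //= ler_wpDr ?sumr_ge0 // => i _.
  by rewrite mulr_ge0 ?exprn_ge0.
rewrite -mulr_sumr ler_wpM2l // -mulr_suml ler_wpM2r ?wnorm_ge0 //.
rewrite /wnorm (big_ord_widen M (fun j => `|p`_j| * r ^+ j)) // big_mkcond /=.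
by apply: ler_sum => i _; case: ifP => // _; rewrite mulr_ge0 ?exprn_ge0.
Qed.

Lemma eqX_xderiv p q : eqX p q -> eqX ('X * p^`()) ('X * q^`()).
Proof.
move=> pq i iM; rewrite ![_ * _^`()]mulrC !coefMX; case: i iM => //= i iM.
by rewrite !coef_deriv pq.
Qed.

End TruncatedSeries.

(** * The cluster bound for an abstract family Y(X; U) *)

Section ClusterBound.
Import boot.fintype boot.finset.
Local Open Scope bool_scope.
Local Open Scope ring_scope.
Variables (C : numFieldType) (r q rho eps : C) (M d : nat).
Variables (T : finType) (S : {set T}) (adj : rel T).
Variable y : {set T} -> {set T} -> nat -> C.
Implicit Types (X U : {set T}).

Hypotheses (r_ge0 : 0 <= r) (q_ge0 : 0 <= q) (rho_ge1 : 1 <= rho).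
Hypotheses (q_eps : q * rho ^+ d <= eps) (eps_lt1 : eps < 1).
Hypothesis eps_rho : 1 + eps <= rho * (1 - eps).
Hypothesis adj_deg : forall u, u \in S -> (#|[set v in S | adj u v]| <= d)%N.
Hypothesis y_split : forall X U u m, u \notin X -> u \notin U ->
  y X (u |: U) m = y X U m + y (u |: X) U m.
Hypothesis y_factor : forall X U m, X \subset S -> U \subset S ->
  [disjoint X & U] -> (forall x u, x \in X -> u \in U -> ~~ adj x u) ->
  y X U m = \sum_(i < m.+1) y X set0 i * y set0 U (m - i)%N.
Hypothesis y_bound : forall X, X \subset S ->
  \sum_(m < M) `|y X set0 m| * r ^+ m <= q ^+ #|X|.
Hypothesis y_init : forall X U, y X U 0%N = (X == set0)%:R.
Hypothesis y_empty : forall m, y set0 set0 m = (m == 0%N)%:R.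

Let Y X U : {poly C} := \poly_(m < M) y X U m.

Let YE X U i : (i < M)%N -> (Y X U)`_i = y X U i.
Proof. by move=> iM; rewrite coef_poly iM. Qed.

Let bdry X U := [set u in U | [exists a in X, adj a u]].

Let Y_split X U u : u \notin X -> u \notin U ->
  eqX M (Y X (u |: U)) (Y X U + Y (u |: X) U).
Proof. by move=> uX uU i iM; rewrite coefD !YE // y_split. Qed.

Let eps_ge0 : 0 <= eps.
Proof. by apply: le_trans q_eps; rewrite mulr_ge0 ?exprn_ge0 // (le_trans ler01). Qed.

Let rho_ge0 : 0 <= rho. Proof. exact: le_trans ler01 rho_ge1. Qed.

(** The witness p stands for the quotient Y(X; U) / Z(U), written without division. *)
Definition cluster_claim X U := exists2 p, eqX M (Y X U) (p * Y set0 U)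
  & wnorm r M p <= q ^+ #|X| * rho ^+ #|bdry X U|.

(** Since Z(u + V) = Z(V) + Y(u; V), the quotient for X = {u} is b itself. No word of length 0
    contains u, so b(0) = 0 and 1 + b has an inverse c. *)
Let ratio_step (V : {set T}) u : (0 < M)%N -> u \in S -> V \subset S -> u \notin V ->
  cluster_claim [set u] V ->
  exists b c : {poly C}, [/\ eqX M (Y set0 (u |: V)) ((1 + b) * Y set0 V),
     eqX M ((1 + b) * c) 1, wnorm r M b <= eps & wnorm r M c <= (1 - eps)^-1].
Proof.
move=> M0 uS VS uV [b Yb Nb].
have b0 : (1 + b)`_0 = 1.
  have := Yb 0%N M0; rewrite coefM big_ord1 !YE // !y_init eqxx mulr1 coefD => <-.
  have /set0Pn/negbTE -> : exists x, x \in [set u] by exists u; rewrite inE.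
  by rewrite coef1 addr0.
have [c bc] := @eqX_inv C M (1 + b) b0.
have Nbe : wnorm r M b <= eps.
  apply: le_trans Nb _; apply: le_trans q_eps; rewrite cards1 expr1.
  rewrite ler_wpM2l // ler_weXn2l //; apply: leq_trans (adj_deg uS).
  apply/subset_leq_card/subsetP => v; rewrite !inE => /andP[vV].
  by case/exists_inP => a /set1P ->; rewrite (subsetP VS).
exists b, c; split=> //; last exact: wnorm_inv_le bc Nbe eps_lt1.
have := @Y_split set0 V u; rewrite !inE => /(_ isT uV) YY.
apply: eqX_trans YY _; rewrite mulrDl mul1r setU0.
exact: eqXD (@eqX_refl _ _ _) Yb.
Qed.

(** Absorbing u into X trades the neighbour u for at most d new ones. *)
Let bdry_setU1 X U u : u \in S -> U \subset S -> u \in bdry X U ->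
  (#|bdry (u |: X) (U :\ u)| <= #|bdry X U|.-1 + d)%N.
Proof.
move=> uS US ub.
apply: (@leq_trans #|(bdry X U :\ u) :|: [set v in S | adj u v]|).
  apply/subset_leq_card/subsetP => v; rewrite !inE => /andP[/andP[vu vU]].
  case/exists_inP => a; rewrite !inE => /predU1P[-> uv|aX av].
    by rewrite (subsetP US) // uv orbT.
  by rewrite vu vU; apply/orP; left; apply/exists_inP; exists a.
apply: leq_trans (leq_card_setU _ _) _.
by rewrite leq_add ?adj_deg // (cardsD1 u (bdry X U)) ub.
Qed.

(** Induction on #U. Removing a neighbour u of X from U leaves V and splits Y(X; U) into two
    multiples of Z(V); the inverse c of Z(U) / Z(V) turns them into multiples of Z(U). *)
Lemma cluster_claimP X U : (0 < M)%N -> X \subset S -> U \subset S ->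
  [disjoint X & U] -> cluster_claim X U.
Proof.
move=> M0; have [n] := ubnP #|U|; elim: n X U => // n IH X U Un XS US dXU.
have [b0|[u ub]] := set_0Vmem (bdry X U).
  exists (Y X set0); last first.
    rewrite b0 cards0 expr0 mulr1; apply: le_trans (y_bound XS).
    by rewrite /wnorm; apply: ler_sum => i _; rewrite YE.
  move=> i iM; rewrite YE // y_factor //; last first.
    move=> x u xX uU; apply/negP => xu.
    have : u \in bdry X U by rewrite inE uU; apply/exists_inP; exists x.
    by rewrite b0 inE.
  rewrite coefM; apply: eq_bigr => j _.
  by rewrite !YE // ?(leq_ltn_trans (leq_subr _ _) iM) ?(leq_trans (ltn_ord j)).
have uU : u \in U by move: ub; rewrite inE => /andP[].
have uS := subsetP US _ uU.
pose V := U :\ u.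
have UE : u |: V = U by rewrite setD1K.
have Vn : (#|V| < n)%N by move: Un; rewrite (cardsD1 u U) uU.
have VS : V \subset S by apply: subset_trans US; apply: subsetDl.
have uV : u \notin V by rewrite !inE eqxx.
have uX : u \notin X by rewrite (disjointFl dXU uU).
have dXV : [disjoint X & V] by apply: disjointWr dXU; apply: subsetDl.
have duV : [disjoint [set u] & V] by rewrite disjoints1.
have duXV : [disjoint u |: X & V].
  by rewrite disjoints_subset subUset -!disjoints_subset duV.
have usS : [set u] \subset S by rewrite sub1set.
have [b [c [Zb bc Nb Nc]]] := ratio_step M0 uS VS uV (IH _ _ Vn usS VS duV).
rewrite UE in Zb.
have [p1 Y1 N1] := IH X V Vn XS VS dXV.
have uXS : u |: X \subset S by rewrite subUset usS.
have [p2 Y2 N2] := IH (u |: X) V Vn uXS VS duXV.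
exists ((p1 + p2) * c).
  have YU : eqX M (Y X U) ((p1 + p2) * Y set0 V).
    rewrite -{1}UE; apply: eqX_trans (Y_split uX uV) _.
    by rewrite mulrDl; exact: eqXD Y1 Y2.
  apply: eqX_trans YU _; rewrite -mulrA; apply: eqXM => //.
   apply: eqX_sym; apply: eqX_trans (eqXM (@eqX_refl _ _ c) Zb) _.
  rewrite mulrA [c * _]mulrC -[X in eqX M _ X]mul1r.
  exact: eqXM bc (@eqX_refl _ _ _).
have b1 : (0 < #|bdry X U|)%N by apply/card_gt0P; exists u.
have bV : (#|bdry X V| <= #|bdry X U|.-1)%N.
  rewrite (cardsD1 u (bdry X U)) ub /=; apply/subset_leq_card/subsetP => v.
  by rewrite !inE -!andbA.
apply: le_trans (wnormM _ _ _ _) _ => //.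
have qa0 : 0 <= q ^+ #|X| * rho ^+ #|bdry X U|.-1 by rewrite mulr_ge0 ?exprn_ge0.
(* In p1 the set X has lost the neighbour u; p2 pays q for the letter u and rho^d for its new
   neighbours, that is at most eps times the same bound. *)
have N12 : wnorm r M (p1 + p2) <= q ^+ #|X| * rho ^+ #|bdry X U|.-1 * (1 + eps).
  apply: le_trans (wnormD _ _ _ _) _ => //; rewrite mulrDr mulr1 lerD //.
    apply: le_trans N1 _; rewrite ler_wpM2l ?exprn_ge0 //.
    by rewrite ler_weXn2l.
  apply: le_trans N2 _; rewrite cardsU1 uX exprD expr1.
  apply: le_trans (_ : q ^+ #|X| * rho ^+ #|bdry X U|.-1 * (q * rho ^+ d) <= _).
    rewrite mulrACA -exprD [q * q ^+ _]mulrC ler_wpM2l ?mulr_ge0 ?exprn_ge0 //.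
    by rewrite ler_weXn2l // bdry_setU1.
  by rewrite ler_wpM2l.
apply: le_trans (ler_pM _ _ N12 Nc) _; rewrite ?wnorm_ge0 //.
rewrite -[leRHS]mulr1 -!mulrA ler_wpM2l ?exprn_ge0 //.
(* The power of rho saved by removing u pays for (1 + eps) / (1 - eps). *)
rewrite -{2}(prednK b1) exprSr -!mulrA ler_wpM2l ?exprn_ge0 // mulr1.
by rewrite ler_pdivrMr ?subr_gt0.
Qed.

(** Here l is t Z'/Z, which is additive over the product of ratios: each term of U contributes t b'
    / (1 + b), whose m-th coefficient is at most m r^-m eps / (1 - eps). *)
Lemma cluster_dlog (U : {set T}) : (0 < M)%N -> U \subset S ->
  exists2 l, eqX M ('X * (Y set0 U)^`()) (l * Y set0 U)
    & forall m, (m < M)%N ->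
      `|l`_m| * r ^+ m <= m%:R * (#|U|%:R * (eps / (1 - eps))).
Proof.
move=> M0; have [n] := ubnP #|U|; elim: n U => // n IH U Un US.
have [->|[u uU]] := set_0Vmem U.
  exists 0 => [i iM|m _]; last by rewrite coef0 normr0 cards0 !(mul0r, mulr0).
  rewrite mul0r coef0 mulrC coefMX; case: i iM => //= i iM.
  by rewrite coef_deriv YE // y_empty mul0rn.
have uS := subsetP US _ uU.
pose V := U :\ u.
have UE : u |: V = U by rewrite setD1K.
have cU : #|U| = #|V|.+1 by rewrite (cardsD1 u U) uU.
have Vn : (#|V| < n)%N by rewrite -ltnS -cU.
have VS : V \subset S by apply: subset_trans US; apply: subsetDl.
have uV : u \notin V by rewrite !inE eqxx.
have duV : [disjoint [set u] & V] by rewrite disjoints1.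
have usS : [set u] \subset S by rewrite sub1set.
have [b [c [Zb bc Nb Nc]]] := ratio_step M0 uS VS uV (cluster_claimP M0 usS VS duV).
rewrite UE in Zb.
have [l lV Nl] := IH V Vn VS.
exists ('X * b^`() * c + l).
  apply: eqX_trans (eqX_xderiv Zb) _.
  have -> : 'X * ((1 + b) * Y set0 V)^`() =
      'X * b^`() * Y set0 V + (1 + b) * ('X * (Y set0 V)^`()).
    by rewrite derivM derivD derivC; ring.
  rewrite [X in eqX _ _ X]mulrDl; apply: eqXD.
    rewrite -[_ * c * _]mulrA; apply: eqXM => //.
    apply: eqX_sym; apply: eqX_trans (eqXM (@eqX_refl _ _ c) Zb) _.
    rewrite mulrA [c * _]mulrC -[X in eqX M _ X]mul1r.
    exact: eqXM bc (@eqX_refl _ _ _).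
  apply: eqX_trans (eqXM (@eqX_refl _ _ (1 + b)) lV) _.
  by rewrite mulrCA; apply: eqXM => //; apply: eqX_sym.
move=> m mM; rewrite coefD; apply: le_trans (_ : `|('X * b^`() * c)`_m| * r ^+ m + `|l`_m| * r ^+ m <= _).
  by rewrite -mulrDl ler_wpM2r ?exprn_ge0 ?ler_normD.
rewrite cU -addn1 natrD mulrDl mul1r mulrDr addrC lerD ?Nl //.
apply: le_trans (norm_coef_dlog_le r_ge0 _ _ mM) _.
by rewrite ler_wpM2l // ler_pM ?wnorm_ge0.
Qed.

End ClusterBound.

(** * Bounded operators on the Hilbert space *)

Section L2Norm.
Local Open Scope sesquilinear_scope.
Variable R : realType.

(** The modulus taken in R rather than in R[i], so that bounds are handled by real arithmetic. *)
Definition cabs (z : R[i]) : R := complex.Re `|z|.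

Lemma cabsE z : `|z| = (cabs z)%:C.
Proof. by rewrite /cabs normc_def. Qed.

Lemma cabs_ge0 z : 0 <= cabs z.
Proof. by rewrite -lecR -cabsE normr_ge0. Qed.

Lemma cabsM x y : cabs (x * y) = cabs x * cabs y.
Proof. by apply: complexI; rewrite -cabsE normrM !cabsE rmorphM. Qed.

Lemma cabsD x y : cabs (x + y) <= cabs x + cabs y.
Proof. by rewrite -lecR rmorphD /= -!cabsE ler_normD. Qed.

Lemma cabs0 : cabs 0 = 0.
Proof. by rewrite /cabs normr0. Qed.

Lemma cabsC (x : R) : cabs x%:C = `|x|.
Proof. by rewrite /cabs normc_def /= expr0n addr0 sqrtr_sqr. Qed.

Lemma cabs_conj z : cabs (z^*)%C = cabs z.
Proof. by rewrite /cabs normcJ. Qed.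

Lemma cabs_eq0 z : cabs z = 0 -> z = 0.
Proof. by move=> z0; apply/eqP; rewrite -normr_eq0 cabsE z0. Qed.

Lemma cabs_sum (I : finType) (P : pred I) (F : I -> R[i]) :
  cabs (\sum_(i | P i) F i) <= \sum_(i | P i) cabs (F i).
Proof.
elim/big_ind2: _ => [|x y z t xy zt|//]; first by rewrite cabs0.
by apply: le_trans (cabsD _ _) _; apply: lerD.
Qed.

(** Lagrange's identity: the double sum of (a_i b_j - a_j b_i)^2 is twice the difference of the two
    sides. *)
Lemma cauchy_schwarz_sqr (I : finType) (a b : I -> R) :
  (\sum_i a i * b i) ^+ 2 <= (\sum_i a i ^+ 2) * (\sum_i b i ^+ 2).
Proof.
have : 0 <= \sum_i \sum_j (a i * b j - a j * b i) ^+ 2.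
  by apply: sumr_ge0 => i _; apply: sumr_ge0 => j _; rewrite sqr_ge0.
under eq_bigr do under eq_bigr do rewrite sqrrB !exprMn.
under eq_bigr do rewrite big_split sumrB /=.
rewrite big_split sumrB /=.
have -> : \sum_i \sum_j a i ^+ 2 * b j ^+ 2 = (\sum_i a i ^+ 2) * (\sum_i b i ^+ 2).
  by rewrite mulr_suml; apply: eq_bigr => i _; rewrite mulr_sumr.
have -> : \sum_i \sum_j a j ^+ 2 * b i ^+ 2 = (\sum_i a i ^+ 2) * (\sum_i b i ^+ 2).
  by rewrite mulrC mulr_suml; apply: eq_bigr => i _; rewrite mulr_sumr;
     apply: eq_bigr => j _; rewrite mulrC.
have -> : \sum_i \sum_j a i * b j * (a j * b i) *+ 2 = (\sum_i a i * b i) ^+ 2 *+ 2.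
  rewrite expr2 mulr_suml -sumrMnl; apply: eq_bigr => i _.
  rewrite mulr_sumr -sumrMnl; apply: eq_bigr => j _; congr (_ *+ _); ring.
by rewrite -subr_ge0 !mulr2n; lra.
Qed.

Lemma l2norm_ge0 N (v : 'cV[R[i]]_N) : 0 <= l2norm v.
Proof. exact: sqrtr_ge0. Qed.

Lemma sqr_l2norm N (v : 'cV[R[i]]_N) : l2norm v ^+ 2 = \sum_i cabs (v i 0) ^+ 2.
Proof. by rewrite sqr_sqrtr // sumr_ge0 // => i _; rewrite sqr_ge0. Qed.

Lemma cauchy_schwarz (N : nat) (a b : 'cV[R[i]]_N) :
  \sum_i cabs (a i 0) * cabs (b i 0) <= l2norm a * l2norm b.
Proof.
rewrite -(@ler_pXn2r _ 2) ?nnegrE ?mulr_ge0 ?l2norm_ge0 //.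
  by rewrite exprMn !sqr_l2norm cauchy_schwarz_sqr.
by apply: sumr_ge0 => i _; rewrite mulr_ge0 ?cabs_ge0.
Qed.

Lemma l2normD N (u v : 'cV[R[i]]_N) : l2norm (u + v) <= l2norm u + l2norm v.
Proof.
rewrite -(@ler_pXn2r _ 2) ?nnegrE ?addr_ge0 ?l2norm_ge0 // sqrrD !sqr_l2norm.
apply: le_trans (_ : \sum_i (cabs (u i 0) + cabs (v i 0)) ^+ 2 <= _).
  apply: ler_sum => i _; rewrite mxE ler_pXn2r ?nnegrE ?addr_ge0 ?cabs_ge0 //.
  exact: cabsD.
under eq_bigr do rewrite sqrrD.
by rewrite big_split big_split /= lerD2r lerD2l sumrMnl lerMn2r cauchy_schwarz.
Qed.

Lemma l2normZ N c (v : 'cV[R[i]]_N) : l2norm (c *: v) = cabs c * l2norm v.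
Proof.
apply/eqP; rewrite -(@eqrXn2 _ 2) ?mulr_ge0 ?cabs_ge0 ?l2norm_ge0 //.
rewrite exprMn !sqr_l2norm mulr_sumr; apply/eqP; apply: eq_bigr => i _.
by rewrite mxE cabsM exprMn.
Qed.

Lemma l2norm0 N : l2norm (0 : 'cV[R[i]]_N) = 0.
Proof. by rewrite -(scale0r (0 : 'cV[R[i]]_N)) l2normZ cabs0 mul0r. Qed.

Lemma l2norm_eq0 N (v : 'cV[R[i]]_N) : l2norm v = 0 -> v = 0.
Proof.
move=> v0; have := sqr_l2norm v; rewrite v0 expr0n /= => /esym/eqP.
rewrite psumr_eq0 => [/allP H|i _]; last by rewrite sqr_ge0.
apply/colP => i; rewrite mxE; apply: cabs_eq0; apply/eqP.
by have := H i (mem_index_enum _); rewrite sqrf_eq0.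
Qed.

Definition opbound N (c : R) (A : 'M[R[i]]_N) :=
  forall v : 'cV[R[i]]_N, l2norm (A *m v) <= c * l2norm v.

Lemma opbound_opnorm1 N (A : 'M[R[i]]_N) : opnorm A = 1 -> opbound 1 A.
Proof.
rewrite /opnorm; set B := [set _ | _ in _] => B1 v.
(* [sup] is 0 on a set without supremum, so the value 1 certifies that B has one. *)
have hB : has_sup B.
  by apply: contrapT => /sup_out; rewrite B1 => /eqP; rewrite oner_eq0.
rewrite mul1r; have [v0|v0] := eqVneq (l2norm v) 0.
  by rewrite (l2norm_eq0 v0) mulmx0 l2norm0.
have vp : 0 < l2norm v by rewrite lt_neqAle eq_sym v0 l2norm_ge0.
have := sup_upper_bound hB; rewrite B1.
move=> /(_ (l2norm (A *m ((l2norm v)^-1%:C *: v)))).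
rewrite -scalemxAr l2normZ cabsC ger0_norm ?invr_ge0 ?l2norm_ge0 //.
rewrite mulrC ler_pdivrMr // mul1r; apply.
exists ((l2norm v)^-1%:C *: v) => /=; last first.
  by rewrite -scalemxAr l2normZ cabsC ger0_norm ?invr_ge0 ?l2norm_ge0 // mulrC.
by rewrite l2normZ cabsC ger0_norm ?invr_ge0 ?l2norm_ge0 // mulVf.
Qed.

Lemma opbound1 N : opbound 1 (1 : 'M[R[i]]_N).
Proof. by move=> v; rewrite mul1mx mul1r. Qed.

Lemma opbound0 N : opbound 0 (0 : 'M[R[i]]_N).
Proof. by move=> v; rewrite mul0mx l2norm0 mul0r. Qed.

Lemma opboundD N a b (A B : 'M[R[i]]_N) :
  opbound a A -> opbound b B -> opbound (a + b) (A + B).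
Proof.
move=> bA bB v; rewrite mulmxDl mulrDl; apply: le_trans (l2normD _ _) _.
exact: lerD.
Qed.

Lemma opboundM N a b (A B : 'M[R[i]]_N) : 0 <= a ->
  opbound a A -> opbound b B -> opbound (a * b) (A * B).
Proof.
move=> a0 bA bB v; rewrite -mulmxE -mulmxA; apply: le_trans (bA _) _.
by rewrite -mulrA ler_wpM2l.
Qed.

Lemma opboundZ N a c (A : 'M[R[i]]_N) :
  opbound a A -> opbound (cabs c * a) (c *: A).
Proof.
by move=> bA v; rewrite -scalemxAl l2normZ -mulrA ler_wpM2l ?cabs_ge0.
Qed.

Lemma opbound_sum N (I : finType) (P : pred I) a (F : I -> 'M[R[i]]_N) :
  (forall i, P i -> opbound a (F i)) ->
  opbound (#|P|%:R * a) (\sum_(i | P i) F i).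
Proof.
move=> bF; rewrite mulr_natl -sumr_const.
elim/big_ind2: _ => [|A x B y|i]; [exact: opbound0 | exact: opboundD | exact: bF].
Qed.

Lemma le_opbound N a b (A : 'M[R[i]]_N) : a <= b -> opbound a A -> opbound b A.
Proof.
by move=> ab bA v; apply: le_trans (bA v) _; rewrite ler_wpM2r ?l2norm_ge0.
Qed.

Definition ev N (Phi : 'cV[R[i]]_N) (A : 'M[R[i]]_N) : R[i] :=
  (Phi ^t* *m A *m Phi) 0 0.

Lemma evE N (Phi : 'cV[R[i]]_N) A :
  ev Phi A = \sum_s \sum_t conjc (Phi s 0) * A s t * Phi t 0.
Proof.
rewrite /ev mxE exchange_big /=; apply: eq_bigr => t _; rewrite mxE mulr_suml.
by apply: eq_bigr => s _; rewrite !mxE.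
Qed.

Lemma evD N (Phi : 'cV[R[i]]_N) A B : ev Phi (A + B) = ev Phi A + ev Phi B.
Proof. by rewrite /ev mulmxDr mulmxDl mxE. Qed.

Lemma evZ N (Phi : 'cV[R[i]]_N) c A : ev Phi (c *: A) = c * ev Phi A.
Proof. by rewrite /ev -scalemxAr -scalemxAl mxE. Qed.

Lemma ev0 N (Phi : 'cV[R[i]]_N) : ev Phi 0 = 0.
Proof. by rewrite -[0](scale0r (0 : 'M[R[i]]_N)) evZ mul0r. Qed.

Lemma ev_sum N (Phi : 'cV[R[i]]_N) I (s : seq I) (P : pred I)
    (F : I -> 'M[R[i]]_N) :
  ev Phi (\sum_(i <- s | P i) F i) = \sum_(i <- s | P i) ev Phi (F i).
Proof. by apply: (big_morph (ev Phi)) => [A B|]; [exact: evD | exact: ev0]. Qed.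

Lemma cabs_ev N (Phi : 'cV[R[i]]_N) c A :
  l2norm Phi = 1 -> opbound c A -> cabs (ev Phi A) <= c.
Proof.
move=> P1 bA; have -> : ev Phi A = \sum_s conjc (Phi s 0) * (A *m Phi) s 0.
  by rewrite /ev -mulmxA mxE; apply: eq_bigr => s _; rewrite !mxE.
apply: le_trans (cabs_sum _ _) _.
under eq_bigr do rewrite cabsM cabs_conj.
apply: le_trans (cauchy_schwarz _ _) _.
by rewrite P1 mul1r; have := bA Phi; rewrite P1 mulr1.
Qed.

Lemma cabs_entry N c (A : 'M[R[i]]_N) s t : opbound c A -> cabs (A s t) <= c.
Proof.
move=> bA; pose e : 'cV[R[i]]_N := delta_mx t 0.
have e1 : l2norm e = 1.
  apply/eqP; rewrite -(@eqrXn2 _ 2) ?l2norm_ge0 // sqr_l2norm (bigD1 t) //=.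
  rewrite mxE !eqxx /= cabsC normr1 big1 ?addr0 // => i it.
  by rewrite mxE (negbTE it) /= cabs0 expr0n.
have -> : A s t = (A *m e) s 0 by rewrite -colE mxE.
have := bA e; rewrite e1 mulr1; apply: le_trans.
rewrite -(@ler_pXn2r _ 2) ?nnegrE ?cabs_ge0 ?l2norm_ge0 // sqr_l2norm.
by rewrite (bigD1 s) //= ler_wpDr // sumr_ge0 // => i _; rewrite sqr_ge0.
Qed.

End L2Norm.

(** * Local operators and product states *)

Section Locality.
Import boot.fintype boot.finset.
Variables (R : realType) (d n : nat).
Local Notation config := (config d n).
Local Notation operator := (operator R d n).
Implicit Types (X Y : {set 'I_n}) (s t u : config) (A B : operator).

Definition entry A s t : R[i] := A (enum_rank s) (enum_rank t).

Definition agree X s t := [forall i in X, s i == t i].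

Lemma agreeP X s t : reflect (forall i, i \in X -> s i = t i) (agree X s t).
Proof. by apply: (iffP forall_inP) => H i iX; apply/eqP; rewrite ?H //; apply/eqP/H. Qed.

Lemma restrict_eq X s t : (Defs.restrict X s == Defs.restrict X t) = agree X s t.
Proof.
apply/eqP/agreeP => [/ffunP E i iX|E]; last first.
  by apply/ffunP => -[i iX]; rewrite !ffunE; exact: E.
by have := E (exist _ i iX); rewrite !ffunE.
Qed.

Lemma sum_config (F : 'I_(hdim d n) -> R[i]) :
  \sum_i F i = \sum_(s : config) F (enum_rank s).
Proof. by rewrite (reindex (@enum_rank config)) //; exact/onW_bij/enum_rank_bij. Qed.

(** What [acts_on X] says about entries, with the witness B eliminated; this form passes to larger
    regions, sums and products. *)
Definition local_on X A := forall s t,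
  (~~ agree (~: X) s t -> entry A s t = 0) /\
  forall s' t', agree X s s' -> agree X t t' ->
    agree (~: X) s t -> agree (~: X) s' t' -> entry A s t = entry A s' t'.

Lemma acts_on_local X A : acts_on X A -> local_on X A.
Proof.
move=> [B AB] s t; split=> [st|s' t' ss tt st st'].
  by rewrite /entry AB restrict_eq (negbTE st) mulr0.
rewrite /entry !AB !restrict_eq st st'.
by move: ss tt; rewrite -!restrict_eq => /eqP -> /eqP ->.
Qed.

Lemma agree_sub X Y s t : X \subset Y -> agree Y s t -> agree X s t.
Proof. by move=> /subsetP XY /agreeP st; apply/agreeP => i /XY; exact: st. Qed.

Lemma local_on_sub X Y A : X \subset Y -> local_on X A -> local_on Y A.
Proof.
move=> XY AX s t; have YX : ~: Y \subset ~: X by rewrite setCS.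
split=> [st|s' t' ss tt st st'].
  by apply: (AX s t).1; apply: contraNN st; exact: agree_sub.
have E : agree (~: X) s t = agree (~: X) s' t'.
  apply/agreeP/agreeP => H i iX; have [iY|iY] := boolP (i \in Y).
  - by rewrite -(agreeP _ _ _ ss) // -(agreeP _ _ _ tt) // H.
  - by apply: (agreeP _ _ _ st'); rewrite inE.
  - by rewrite (agreeP _ _ _ ss) // (agreeP _ _ _ tt) // H.
  - by apply: (agreeP _ _ _ st); rewrite inE.
have [st2|st2] := boolP (agree (~: X) s t).
  by apply: (AX s t).2 => //; rewrite -?E //; exact: agree_sub XY _.
by rewrite (AX s t).1 // (AX s' t').1 // -E.
Qed.

Definition mix X s t : config := [ffun i => if i \in X then s i else t i].

Lemma mixC X s t : mix (~: X) s t = mix X t s.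
Proof. by apply/ffunP => i; rewrite !ffunE inE; case: (i \in X). Qed.

Lemma mix_inl X s t : agree X (mix X s t) s.
Proof. by apply/agreeP => i iX; rewrite ffunE iX. Qed.

Lemma mix_inr X s t : agree (~: X) (mix X s t) t.
Proof. by apply/agreeP => i; rewrite inE ffunE => /negbTE ->. Qed.

Lemma agree_sym X s t : agree X s t = agree X t s.
Proof. by apply/agreeP/agreeP => H i iX; rewrite H. Qed.

Lemma agree_trans X s t u : agree X s t -> agree X t u -> agree X s u.
Proof. by move=> /agreeP H /agreeP K; apply/agreeP => i iX; rewrite H // K. Qed.

Lemma agree_refl X s : agree X s s.
Proof. exact/agreeP. Qed.

Lemma agree_mix X s t u :
  agree (~: X) s u -> agree X u t -> u = mix X t s.
Proof.
move=> /agreeP su /agreeP ut; apply/ffunP => i; rewrite ffunE.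
by case: ifP => iX; [rewrite ut | rewrite su // inE iX].
Qed.

Lemma entryM A B s t : entry (A * B) s t = \sum_u entry A s u * entry B u t.
Proof. by rewrite /entry -mulmxE mxE sum_config. Qed.

(** A fixes the sites off X and B those in X, so the only intermediate configuration has the X-part
    of t and the rest of s. *)
Lemma entry_mul_disjoint X A B s t : local_on X A -> local_on (~: X) B ->
  entry (A * B) s t = entry A s (mix X t s) * entry B (mix X t s) t.
Proof.
move=> AX BX; rewrite entryM (bigD1 (mix X t s)) //= big1 ?addr0 // => u ut.
have [su|su] := boolP (agree (~: X) s u); last by rewrite (AX s u).1 ?mul0r.
have [ut'|ut'] := boolP (agree X u t).
  by rewrite (agree_mix su ut') eqxx in ut.
by rewrite (BX u t).1 ?mulr0 // setCK.
Qed.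

(** Both orders pass through a single intermediate configuration, and the entries to be compared
    differ only at sites on which the operator does not act. *)
Lemma local_onC X A B : local_on X A -> local_on (~: X) B -> A * B = B * A.
Proof.
move=> AX BX; have E s t : entry (A * B) s t = entry (B * A) s t.
  rewrite (entry_mul_disjoint _ _ AX BX) (@entry_mul_disjoint (~: X)) ?setCK //.
  rewrite mixC mulrC; congr (_ * _).
    apply: (BX _ _).2; rewrite ?setCK ?mix_inr ?mix_inl //.
    - by rewrite agree_sym mix_inr.
    - by rewrite agree_sym mix_inl.
  apply: (AX _ _).2; rewrite ?mix_inr ?mix_inl //.
  - by rewrite agree_sym mix_inl.
  - by rewrite agree_sym mix_inr.
apply/matrixP => i j; have := E (enum_val i) (enum_val j).
by rewrite /entry !enum_valK.
Qed.

Lemma local_on0 X : local_on X 0.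
Proof. by move=> s t; rewrite /entry; split=> *; rewrite !mxE. Qed.

Lemma local_on1 X : local_on X 1.
Proof.
move=> s t; split=> [st|s' t' ss tt st st']; rewrite /entry !mxE !(inj_eq enum_rank_inj).
  by case: eqP st => // ->; rewrite agree_refl.
suff -> : (s == t) = (s' == t') by [].
apply/eqP/eqP => E; apply/ffunP => i; have [iX|iX] := boolP (i \in X).
- by rewrite -(agreeP _ _ _ ss) // -(agreeP _ _ _ tt) // E.
- by apply: (agreeP _ _ _ st'); rewrite inE.
- by rewrite (agreeP _ _ _ ss) // (agreeP _ _ _ tt) // E.
- by apply: (agreeP _ _ _ st); rewrite inE.
Qed.

Lemma local_onD X A B : local_on X A -> local_on X B -> local_on X (A + B).
Proof.
move=> AX BX s t; rewrite /entry; split=> [st|s' t' ss tt st st']; rewrite !mxE.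
  by rewrite -!/(entry _ _ _) (AX s t).1 // (BX s t).1 // addr0.
rewrite -!/(entry _ _ _).
by rewrite ((AX s t).2 s' t') // ((BX s t).2 s' t').
Qed.

Lemma local_onZ X c A : local_on X A -> local_on X (c *: A).
Proof.
move=> AX s t; rewrite /entry; split=> [st|s' t' ss tt st st']; rewrite !mxE.
  by rewrite -!/(entry _ _ _) (AX s t).1 // mulr0.
by rewrite -!/(entry _ _ _) ((AX s t).2 s' t').
Qed.

Lemma local_onM X A B : local_on X A -> local_on X B -> local_on X (A * B).
Proof.
move=> AX BX s t; split=> [st|s' t' ss tt st st'].
  rewrite entryM big1 // => u _; have [su|su] := boolP (agree (~: X) s u).
    rewrite (BX u t).1 ?mulr0 //; apply: contraNN st; exact: agree_trans su.
  by rewrite (AX s u).1 // mul0r.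
have entryE a b : agree (~: X) a b -> entry (A * B) a b =
    \sum_(u | agree (~: X) u a) entry A a u * entry B u b.
  move=> ab; rewrite entryM [RHS]big_mkcond /=; apply: eq_bigr => u _.
  by case: ifPn => // ua; rewrite (AX a u).1 ?mul0r // agree_sym.
(* Intermediate configurations over the background s are matched with those over s' by changing
   their part off X. *)
rewrite !entryE // (reindex_onto (mix X ^~ s) (mix X ^~ s')) /=; last first.
  move=> u us; apply/ffunP => i; rewrite !ffunE; case: ifP => iX; rewrite ?iX //.
  by move: (agreeP _ _ _ us i); rewrite inE iX => ->.
apply: eq_big => u /=.
  rewrite mix_inr /=; apply/eqP/idP => [<-|us]; first exact: mix_inr.
  apply/ffunP => i; rewrite !ffunE; case: ifP => iX; rewrite ?iX //.
  by move: (agreeP _ _ _ us i); rewrite inE iX => ->.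
move=> /andP[_ /eqP us']; have us : agree (~: X) u s' by rewrite -us' mix_inr.
congr (_ * _).
  apply: (AX _ _).2 => //; rewrite ?mix_inl //; first by rewrite agree_sym mix_inr.
  by rewrite agree_sym.
apply: (BX _ _).2 => //; rewrite ?mix_inl //.
  exact: agree_trans (mix_inr _ _ _) st.
exact: agree_trans us st'.
Qed.

Lemma local_on_sum X (I : finType) (P : pred I) (F : I -> operator) :
  (forall i, P i -> local_on X (F i)) -> local_on X (\sum_(i | P i) F i).
Proof.
by move=> H; elim/big_ind: _ => //; [exact: local_on0|exact: local_onD].
Qed.

Variable phi : 'I_n -> 'cV[R[i]]_d.

Local Notation Phi := (product_state phi).

Let amp s : R[i] := \prod_i phi i (s i) 0.

Let Phi_amp s : Phi (enum_rank s) 0 = amp s.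
Proof. by rewrite mxE enum_rankK. Qed.

Lemma ev_config A : ev Phi A =
  \sum_s \sum_t conjc (amp s) * entry A s t * amp t.
Proof.
rewrite evE sum_config; apply: eq_bigr => s _; rewrite sum_config.
by apply: eq_bigr => t _; rewrite !Phi_amp.
Qed.

Let amp_mix X s t : amp (mix X s t) * amp (mix X t s) = amp s * amp t.
Proof.
rewrite -!big_split /=; apply: eq_bigr => i _; rewrite !ffunE.
by case: ifP => // _; rewrite mulrC.
Qed.

Let swap X (p : config * config) := (mix X p.1 p.2, mix X p.2 p.1).

Let swapK X : involutive (swap X).
Proof.
move=> [s t]; congr (_, _); apply/ffunP => i; rewrite !ffunE;
  by case: ifP => iX; rewrite ?iX.
Qed.

(* Exchanging the X-parts of two copies of the configuration leaves the
   amplitudes of a product state unchanged, and turns <A><B> into <AB><1>. *)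
Lemma ev_factor X A B : local_on X A -> local_on (~: X) B ->
  ev Phi A * ev Phi B = ev Phi (A * B) * ev Phi 1.
Proof.
move=> AX BX.
have pairE A' B' : ev Phi A' * ev Phi B' =
    \sum_(p : config * config) \sum_(q : config * config)
      conjc (amp p.1 * amp p.2) * (amp q.1 * amp q.2) *
      (entry A' p.1 q.1 * entry B' p.2 q.2).
  rewrite !ev_config mulr_suml.
  rewrite -(pair_bigA _ (fun s s' => \sum_(q : config * config)
      conjc (amp s * amp s') * (amp q.1 * amp q.2) *
      (entry A' s q.1 * entry B' s' q.2))) /=.
  apply: eq_bigr => s _; rewrite mulr_sumr; apply: eq_bigr => s' _.
  rewrite -(pair_bigA _ (fun t t' =>
      conjc (amp s * amp s') * (amp t * amp t') *
      (entry A' s t * entry B' s' t'))) /=.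
  rewrite mulr_suml; apply: eq_bigr => t _; rewrite mulr_sumr.
  by apply: eq_bigr => t' _; rewrite rmorphM /=; ring.
rewrite !pairE (reindex_inj (inv_inj (swapK X))); apply: eq_bigr => -[s s'] _.
rewrite (reindex_inj (inv_inj (swapK X))); apply: eq_bigr => -[t t'] _ /=.
rewrite !amp_mix; congr (_ * _).
rewrite (entry_mul_disjoint _ _ AX BX) [entry 1 _ _]mxE (inj_eq enum_rank_inj).
(* If s' and t' differ, they differ off X, where the entry of A vanishes, or in X, where that of B
   does. This reproduces the entry of the identity. *)
case: eqP => [<-|ne]; last first.
  rewrite mulr0.
  have [H|H] := boolP (agree (~: X) s' t'); last first.
    rewrite (AX _ _).1 ?mul0r //; apply: contraNN H => H.
    apply: agree_trans (mix_inr X t t'); apply: agree_trans H.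
    by rewrite agree_sym mix_inr.
  have [K|K] := boolP (agree X s' t'); last first.
    rewrite (BX _ _).1 ?mulr0 // setCK; apply: contraNN K => K.
    apply: agree_trans (mix_inl X t' t); apply: agree_trans K.
    by rewrite agree_sym mix_inl.
  case: ne; apply/ffunP => i; have [iX|iX] := boolP (i \in X).
    exact: (agreeP _ _ _ K).
  by apply: (agreeP _ _ _ H); rewrite inE.
rewrite mulr1; congr (_ * _).
  apply: (AX _ _).2 => //; rewrite ?mix_inl //.
  - by apply: agree_trans (mix_inl _ _ _) _; rewrite agree_sym mix_inl.
  - by apply: agree_trans (mix_inr _ _ _) _; rewrite agree_sym mix_inr.
  - by rewrite agree_sym mix_inr.
apply: (BX _ _).2 => //; rewrite ?setCK ?mix_inr //.
- by apply: agree_trans (mix_inr _ _ _) _; rewrite agree_sym mix_inr.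
- by apply: agree_trans (mix_inl _ _ _) _; rewrite agree_sym mix_inl.
- by rewrite mix_inl.
Qed.

Hypothesis phi1 : forall i, l2norm (phi i) = 1.

Lemma product_state_norm : l2norm Phi = 1.
Proof.
apply/eqP; rewrite -(@eqrXn2 _ 2) ?l2norm_ge0 // sqr_l2norm expr1n.
rewrite (reindex (@enum_rank config)) /=; last exact/onW_bij/enum_rank_bij.
have -> : \sum_(s : config) cabs (Phi (enum_rank s) 0) ^+ 2 =
    \sum_(s : config) \prod_i cabs (phi i (s i) 0) ^+ 2.
  apply: eq_bigr => s _; rewrite Phi_amp prodrXl; congr (_ ^+ 2).
  rewrite /amp; elim/big_ind2: _ => //; first by rewrite (cabsC 1) normr1.
  by move=> x a y b <- <-; rewrite cabsM.
rewrite -(bigA_distr_bigA (fun i a => cabs (phi i a 0) ^+ 2)) /=.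
by rewrite big1 // => i _; rewrite -sqr_l2norm phi1 expr1n.
Qed.

Lemma ev_one : ev Phi 1 = 1.
Proof.
have : (l2norm Phi ^+ 2)%:C = 1 by rewrite product_state_norm expr1n.
rewrite sqr_l2norm => <-; rewrite /ev mulmx1 mxE rmorph_sum /=.
apply: eq_bigr => i _; rewrite !mxE mulrC rmorphXn /= -cabsE sqr_normc.
by [].
Qed.

End Locality.

(** * Moments of a local Hamiltonian *)

Section ExpGeneratingFunction.
Variable R : realType.

(** An optional letter contributes e^r to the exponential generating function and a compulsory one
    e^r - 1, since it must occupy some position. The induction on a gets the second from the first
    by [nb_words_split]. *)
Lemma cvg_nb_words (r : R) a u :
  series (fun m => (nb_words m a u)%:R * r ^+ m / m`!%:R) @ \oo -->
  expR (r * u%:R) * (expR r - 1) ^+ a.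
Proof.
elim: a u => [|a IH] u.
  rewrite mulr1 (_ : (fun _ => _) = exp_coeff (r * u%:R)).
    exact: is_cvg_series_exp_coeff.
  by apply/funext => i; rewrite nb_words0 natrX /exp_coeff /= exprMn
    [r ^+ _ * _]mulrC.
have -> : expR (r * u%:R) * (expR r - 1) ^+ a.+1 =
    expR (r * u.+1%:R) * (expR r - 1) ^+ a - expR (r * u%:R) * (expR r - 1) ^+ a.
  by rewrite -natr1 mulrDr mulr1 expRD exprS; ring.
rewrite [X in X @ _ --> _](_ : _ =
  series (fun m => (nb_words m a u.+1)%:R * r ^+ m / m`!%:R) -
  series (fun m => (nb_words m a u)%:R * r ^+ m / m`!%:R)).
  exact: cvgB.
apply/funext => n; rewrite fctE /series /= -sumrB; apply: eq_bigr => i _.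
by rewrite -mulrBl -mulrBl -nb_words_split natrD addrK.
Qed.

Lemma sum_nb_words_le (r : R) a u M : 0 <= r ->
  \sum_(m < M) (nb_words m a u)%:R * r ^+ m / m`!%:R <=
  expR (r * u%:R) * (expR r - 1) ^+ a.
Proof.
move=> r0; set w := fun m => (nb_words m a u)%:R * r ^+ m / m`!%:R.
have cw := @cvg_nb_words r a u.
have := @nondecreasing_cvgn_le _ (series w) _ (cvgP _ cw) M.
rewrite (cvg_lim _ cw) // /series /= big_mkord; apply.
apply: nondecreasing_series => i _ _.
by rewrite /w divr_ge0 // mulr_ge0 // exprn_ge0.
Qed.

End ExpGeneratingFunction.

Section HamiltonianTerms.
Import boot.fintype boot.finset.
Local Open Scope bool_scope.
Variables (R : realType) (d n k deg : nat) (H : hamiltonian R d n).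
Variable phi : 'I_n -> 'cV[R[i]]_d.
Hypotheses (Hloc : is_local k H) (Hdeg : (max_degree H <= deg)%N).
Hypothesis phi1 : forall i, l2norm (phi i) = 1.
Local Notation S := (ham_terms H).
Local Notation Phi := (product_state phi).
Implicit Types X U : {set {set 'I_n}}.

(** With the factor -i in the letters, exp(-itH) is the exponential of t times the sum of the
    letters. *)
Definition term_op (x : {set 'I_n}) : operator R d n :=
  (- 'i * (ham_coef H x)%:C) *: ham_op H x.

Lemma opbound_term x : x \in S -> opbound 1 (term_op x).
Proof.
move=> /Hloc[_ l1 _ _ /opbound_opnorm1 h1].
apply: le_opbound (opboundZ _ h1); rewrite mulr1 cabsM cabsC.
have -> : cabs (- 'i : R[i]) = 1.
  by rewrite /cabs normc_def /= oppr0 expr0n add0r sqrrN expr1n sqrtr1.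
by rewrite mul1r.
Qed.

Lemma local_on_term x : x \in S -> local_on x (term_op x).
Proof. by move=> /Hloc[_ _ _ [/acts_on_local hx _] _]; exact: local_onZ. Qed.

(** Every word is a product of contractions, so counting words bounds the norm. *)
Lemma opbound_words m X U : X \subset S -> U \subset S -> [disjoint X & U] ->
  opbound (nb_words m #|X| #|U|)%:R (words term_op m X U).
Proof.
elim: m X U => [|m IH] X U XS US dXU /=.
  rewrite cards_eq0; case: eqP => _; [exact: opbound1 | exact: opbound0].
rewrite natrD !natrM; apply: opboundD; apply: opbound_sum => x xS.
  rewrite -[_%:R]mul1r; apply: opboundM => //; first exact/opbound_term/(subsetP US).
  exact: IH.
rewrite -[_%:R]mul1r; apply: opboundM => //; first exact/opbound_term/(subsetP XS).
have {}xS : x \in X := xS.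
have xU : x \notin U by rewrite (disjointFr dXU xS).
have <- : #|X :\ x| = #|X|.-1 by rewrite (cardsD1 x X) xS.
have <- : #|x |: U| = #|U|.+1 by rewrite cardsU1 xU.
apply: IH.
- by apply: subset_trans XS; exact: subsetDl.
- by rewrite subUset sub1set (subsetP XS).
rewrite disjoints_subset; apply/subsetP => z; rewrite !inE negb_or => /andP[-> zX].
by rewrite (disjointFr dXU zX).
Qed.

Lemma local_on_words (Z : {set 'I_n}) m X U : (forall x, x \in X :|: U -> x \subset Z) ->
  X \subset S -> U \subset S -> local_on Z (words term_op m X U).
Proof.
elim: m X U => [|m IH] X U ZXU XS US /=.
  by case: eqP => _; [exact: local_on1 | exact: local_on0].
apply: local_onD; apply: local_on_sum => x xS; apply: local_onM.
- apply: local_on_sub (local_on_term (subsetP US _ xS)).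
  by apply: ZXU; rewrite inE xS orbT.
- exact: IH.
- apply: local_on_sub (local_on_term (subsetP XS _ xS)).
  by apply: ZXU; rewrite inE xS.
apply: IH.
- move=> z; rewrite !inE => Hz; apply: ZXU; rewrite inE.
  by case: (z =P x) Hz => [->|] /=; rewrite ?xS.
- by apply: subset_trans XS; exact: subsetDl.
- by rewrite subUset sub1set (subsetP XS).
Qed.

(** The m-th coefficient of Y(X; U); for X empty and U = S it is a Taylor coefficient of the
    amplitude. *)
Definition moment X U m : R[i] := (m`!%:R)^-1 * ev Phi (words term_op m X U).

Lemma moment_split X U u m : u \notin X -> u \notin U ->
  moment X (u |: U) m = moment X U m + moment (u |: X) U m.
Proof. by move=> uX uU; rewrite /moment words_split // evD mulrDr. Qed.

Lemma moment_init X U : moment X U 0 = (X == set0)%:R.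
Proof.
rewrite /moment /= invr1 mul1r; case: eqP => _ /=; last exact: ev0.
exact: ev_one.
Qed.

Lemma moment_empty m : moment set0 set0 m = (m == 0%N)%:R.
Proof.
case: m => [|m]; first by rewrite moment_init eqxx.
by rewrite /moment words_set0 big_set0 expr0n /= ev0 mulr0.
Qed.

Lemma moment_factor X U m : X \subset S -> U \subset S -> [disjoint X & U] ->
  (forall x u, x \in X -> u \in U -> ~~ interaction_graph H x u) ->
  moment X U m = \sum_(i < m.+1) moment X set0 i * moment set0 U (m - i)%N.
Proof.
move=> XS US dXU nadj.
have dxu x u : x \in X -> u \in U -> x \subset ~: u.
  move=> xX uU; have := nadj x u xX uU.
  rewrite /interaction_graph (subsetP XS) // (subsetP US) //=.
  have [xu|_ /=] := eqVneq x u; last by rewrite negbK disjoints_subset.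
  by rewrite -xu (disjointFr dXU xX) in uU.
have d0U : [disjoint (set0 : {set {set 'I_n}}) & U].
  by rewrite disjoints_subset sub0set.
have hcomm x u : x \in X :|: set0 -> u \in U ->
    GRing.comm (term_op x) (term_op u).
  rewrite setU0 => xX uU; apply: (@local_onC _ _ _ x).
    exact/local_on_term/(subsetP XS).
  apply: local_on_sub (local_on_term (subsetP US _ uU)).
  by rewrite -setCS setCK dxu.
have := @words_binomial _ _ term_op m X set0 U d0U dXU hcomm.
rewrite set0U {1}/moment => ->.
rewrite ev_sum mulr_sumr; apply: eq_bigr => j _.
rewrite -(words_set0 term_op (m - j)).
have jm : (j <= m)%N by rewrite -ltnS.
have -> : ev Phi (words term_op j X set0 * words term_op (m - j) set0 U *+ 'C(m, j)) =
    ev Phi (words term_op j X set0) * ev Phi (words term_op (m - j) set0 U) *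
    'C(m, j)%:R.
  rewrite -scaler_nat evZ mulrC; congr (_ * _).
  (* The union of the terms of X separates the two factors: every term of U lies in its
     complement. *)
  rewrite (@ev_factor _ _ _ phi (\bigcup_(x in X) x)); first by rewrite ev_one // mulr1.
  - apply: local_on_words; rewrite ?sub0set // => x; rewrite setU0 => xX.
    exact: bigcup_sup.
  - apply: local_on_words; rewrite ?sub0set // => u; rewrite set0U => uU.
    rewrite -setCS setCK; apply/bigcupsP => x xX; exact: dxu.
rewrite /moment -(bin_fact jm) !natrM; set a := ev _ _; set b := ev _ _.
have nz i : i`!%:R != 0 :> R[i] by rewrite pnatr_eq0 -lt0n fact_gt0.
have bz : 'C(m, j)%:R != 0 :> R[i] by rewrite pnatr_eq0 -lt0n bin_gt0.
by field; rewrite !nz bz.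
Qed.

Lemma cabs_moment_le X U m : X \subset S -> U \subset S -> [disjoint X & U] ->
  cabs (moment X U m) <= (nb_words m #|X| #|U|)%:R / m`!%:R.
Proof.
move=> XS US dXU; rewrite cabsM mulrC.
have -> : (m`!%:R)^-1 = ((m`!%:R)^-1)%:C :> R[i] by rewrite fmorphV rmorph_nat.
rewrite cabsC ger0_norm ?invr_ge0 // ler_wpM2r ?invr_ge0 //.
by apply: cabs_ev; [exact: product_state_norm | exact: opbound_words].
Qed.

Lemma sum_moment_le X U M (r : R) : 0 <= r ->
  X \subset S -> U \subset S -> [disjoint X & U] ->
  \sum_(m < M) `|moment X U m| * r%:C ^+ m <=
  (expR (r * #|U|%:R) * (expR r - 1) ^+ #|X|)%:C.
Proof.
move=> r0 XS US dXU; apply: le_trans (_ : (\sum_(m < M)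
    (nb_words m #|X| #|U|)%:R * r ^+ m / m`!%:R)%:C <= _); last first.
  by rewrite lecR; exact: sum_nb_words_le.
rewrite rmorph_sum /=; apply: ler_sum => m _.
rewrite cabsE -rmorphXn -rmorphM lecR mulrAC ler_wpM2r ?exprn_ge0 //.
exact: cabs_moment_le.
Qed.

Lemma interaction_degree u : u \in S ->
  (#|[set v in S | interaction_graph H u v]| <= deg)%N.
Proof.
move=> uS; apply: leq_trans Hdeg; apply: leq_trans (leq_bigmax_cond _ uS).
by apply/subset_leq_card/subsetP => v; rewrite !inE => /andP[].
Qed.

(** Distinct terms containing a common site are neighbours, so a site lies in at most deg + 1 terms;
    the extra 1 counts a possible term with empty support. *)
Lemma card_ham_terms : (#|S| <= (n * deg.+1).+1)%N.
Proof.
pose at_site (i : 'I_n) := [set X in S | i \in X].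
have at_le i : (#|at_site i| <= deg.+1)%N.
  have [->|[X]] := set_0Vmem (at_site i); first by rewrite cards0.
  rewrite inE => /andP[XS iX].
  apply: (@leq_trans #|X |: [set v in S | interaction_graph H X v]|).
    apply/subset_leq_card/subsetP => Y; rewrite !inE => /andP[YS iY].
    have [//|YX] := eqVneq Y X; rewrite YS /interaction_graph XS YS eq_sym YX.
    by apply/pred0Pn; exists i; rewrite !inE iX.
  rewrite cardsU1 -[deg.+1]add1n; apply: leq_add (interaction_degree XS); exact: leq_b1.
have : S \subset set0 |: \bigcup_i at_site i.
  apply/subsetP => X XS; rewrite !inE; have [//|/set0Pn[i iX]] := eqVneq X set0.
  by apply/bigcupP; exists i; rewrite // inE XS.
move/subset_leq_card/leq_trans; apply; rewrite cardsU1 -add1n.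
apply: leq_add (leq_b1 _) _; rewrite -[n in (_ <= n * _)%N]card_ord -sum_nat_const.
elim/big_ind2: _ => [|A a B b Aa Bb|i _]; rewrite ?cards0 ?at_le //.
by apply: leq_trans (leq_card_setU _ _) _; exact: leq_add.
Qed.

(* With rho = 1 + 1/deg and eps = 1/(2 deg + 1) one has
   (1 + eps)/(1 - eps) = rho and rho^deg <= e. *)
Lemma cluster_constants (e1 := expR 1 : R) (tL := loschmidt_time R deg) :
  (1 <= deg)%N ->
  [/\ 0 < tL, 0 <= expR tL - 1,
    (expR tL - 1) * (1 + deg%:R^-1) ^+ deg <= (2 * deg + 1)%N%:R^-1 &
    1 + (2 * deg + 1)%N%:R^-1 <= (1 + deg%:R^-1) * (1 - (2 * deg + 1)%N%:R^-1) :> R].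
Proof.
move=> deg1; have d1 : 1 <= deg%:R :> R by rewrite ler1n.
have e2 : 2 <= e1 by have := expR_ge1Dx (1 : R); rewrite /e1; lra.
have tL0 : 0 < tL.
  by rewrite /tL /loschmidt_time div1r invr_gt0 !mulr_gt0 ?exprn_gt0 ?expR_gt0 ?ltr0n.
have rho_e : (1 + deg%:R^-1) ^+ deg <= e1.
  apply: le_trans (_ : expR deg%:R^-1 ^+ deg <= _).
    rewrite lerXn2r ?nnegrE ?expR_ge0 ?addr_ge0 ?invr_ge0 //.
    exact: expR_ge1Dx.
  by rewrite -expRM_natl mulfV // pnatr_eq0 -lt0n.
have tLE : tL * e1 * (e1 * deg%:R * deg.+1%:R) * 2 = 1.
  rewrite /tL /loschmidt_time -/e1; field.
  by rewrite !gt_eqF ?ltr0n ?(lt_le_trans _ e2) // (lt_le_trans _ d1).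
rewrite -natr1 in tLE; set D : R := deg%:R in d1 tLE rho_e *.
(* Together with [tLE] this gives 2 tL e <= 1 / (2 D + 1), which bounds q rho^deg once q <= 2 tL and
   rho^deg <= e. *)
have De : 2 * D + 1 <= e1 * D * (D + 1) by nra.
have tL12 : tL <= 1 / 2.
  have : 2 <= e1 * (e1 * D * (D + 1)) by nra.
  rewrite -mulrA in tLE; nra.
(* From e^-t >= 1 - t follows e^t (1 - t) <= 1, while 1 <= (1 + 2 t)(1 - t) for 0 <= t <= 1/2. *)
have qtL : expR tL - 1 <= 2 * tL.
  have := expR_ge1Dx (- tL); rewrite expRN => h.
  have h2 : expR tL * (1 - tL) <= 1.
    by have := ler_wpM2l (expR_ge0 tL) h; rewrite mulfV // gt_eqF // expR_gt0.
  have h3 : 1 <= (1 + 2 * tL) * (1 - tL) by nra.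
  have h4 : 0 < 1 - tL by lra.
  rewrite lerBlDl -(ler_pM2r h4); exact: le_trans h3.
have q0 : 0 <= expR tL - 1 by rewrite subr_ge0 -expR0 ler_expR ltW.
have nE : (2 * deg + 1)%N%:R = 2 * D + 1 :> R by rewrite natrD natrM.
have n0 : 0 < 2 * D + 1 by lra.
split=> //.
- apply: le_trans (_ : 2 * tL * e1 <= _).
    apply: ler_pM; rewrite ?q0 ?exprn_ge0 ?addr_ge0 ?invr_ge0 ?(le_trans ler01 d1) //.
  rewrite nE -div1r ler_pdivlMr //.
  have te : 0 <= tL * e1 by rewrite mulr_ge0 ?ltW // (lt_le_trans _ e2).
  by have := ler_wpM2l te De; lra.
rewrite le_eqVlt; apply/orP; left; apply/eqP; rewrite nE; field.
by rewrite !gt_eqF //; lra.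
Qed.

(** L collects the coefficients of t Z'/Z for the whole Hamiltonian, free of any truncation. *)
Lemma moment_dlog (tL := loschmidt_time R deg) : (1 <= deg)%N ->
  exists L : nat -> R[i],
    (forall m, m%:R * moment set0 S m =
       \sum_(j < m.+1) L j * moment set0 S (m - j)%N) /\
    (forall m, cabs (L m) * tL ^+ m <= m%:R * #|S|%:R).
Proof.
move=> deg1; have [tL0 q0 q_eps eps_rho] := cluster_constants deg1.
set rho : R := 1 + _ in q_eps eps_rho; set eps : R := _^-1 in q_eps eps_rho.
have eps12 : eps <= 1 / 2.
  have d1 : 1 <= deg%:R :> R by rewrite ler1n.
  by rewrite /eps natrD natrM -div1r ler_pdivrMr; lra.
have eps0 : 0 <= eps by rewrite invr_ge0.
have castE (x : R) : 1 + x%:C = (1 + x)%:C by rewrite rmorphD rmorph1.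
have castB (x : R) : 1 - x%:C = (1 - x)%:C by rewrite rmorphB rmorph1.
have dlog M : exists2 l : {poly R[i]},
    (forall m, (m < M.+1)%N -> m%:R * moment set0 S m =
       \sum_(j < m.+1) l`_j * moment set0 S (m - j)%N)
    & forall m, (m < M.+1)%N -> cabs l`_m * tL ^+ m <= m%:R * #|S|%:R.
  have [l lE lb] : exists2 l : {poly R[i]},
      eqX M.+1 ('X * (\poly_(m < M.+1) moment set0 S m)^`())
        (l * \poly_(m < M.+1) moment set0 S m)
      & forall m, (m < M.+1)%N -> `|l`_m| * tL%:C ^+ m <=
          m%:R * (#|S|%:R * (eps%:C / (1 - eps%:C))).
    apply: (@cluster_dlog _ tL%:C (expR tL - 1)%:C rho%:C eps%:C M.+1 deg
      _ S (interaction_graph H) moment) => //.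
    - by rewrite ler0c ltW.
    - by rewrite ler0c.
    - by rewrite -[1]/(1%:C) lecR lerDl invr_ge0.
    - by rewrite -rmorphXn -rmorphM lecR.
    - by rewrite -[1]/(1%:C) ltcR; lra.
    - by rewrite castE castB -rmorphM lecR.
    - exact: interaction_degree.
    - by move=> *; exact: moment_split.
    - by move=> *; exact: moment_factor.
    - move=> X XS; have := @sum_moment_le X set0 M.+1 tL (ltW tL0) XS (sub0set _).
      rewrite cards0 mulr0 expR0 mul1r rmorphXn; apply.
      by rewrite disjoint_sym disjoints_subset sub0set.
    - by move=> *; exact: moment_init.
    - exact: moment_empty.
  exists l => m mM.
    have := lE m mM; rewrite mulrC coefMX coefM => E.
    transitivity (\sum_(j < m.+1) l`_j *
        (\poly_(i < M.+1) moment set0 S i)`_(m - j)); last first.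
      apply: eq_bigr => j _; rewrite coef_poly.
      by have -> : (m - j < M.+1)%N by lia.
    rewrite -E; case: m mM {E} => [|m] mM /=; first by rewrite mul0r.
    by rewrite coef_deriv coef_poly mM mulr_natl.
  have := lb m mM; rewrite cabsE castB -fmorphV -rmorphM -[_%:R](rmorph_nat (real_complex R)).
  rewrite -[#|S|%:R](rmorph_nat (real_complex R)) -!rmorphM -rmorphXn -rmorphM lecR.
  (* Since eps <= 1/2, each interaction term costs at most 1. *)
  have k1 : eps / (1 - eps) <= 1 by rewrite ler_pdivrMr; lra.
  move/le_trans; apply.
  by rewrite [leRHS]natrM ler_wpM2l // ler_piMr.
pose dlog_mod M (l : {poly R[i]}) :=
  (forall m, (m < M.+1)%N -> m%:R * moment set0 S m =
     \sum_(j < m.+1) l`_j * moment set0 S (m - j)%N) /\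
  forall m, (m < M.+1)%N -> cabs l`_m * tL ^+ m <= m%:R * #|S|%:R.
have [l lE] : {l & forall M, dlog_mod M (l M)}.
  apply: (@boolp.choice _ _ dlog_mod) => M.
  by have [l ? ?] := dlog M; exists l.
(* The moment of order 0 is 1, so the recursion determines each coefficient from the earlier ones:
   all truncations agree, and the diagonal is a single series. *)
have uniq M m : (m <= M)%N -> (l M)`_m = (l m)`_m.
  have [j] := ubnP m; elim: j M m => // j IH M m mj mM.
  have := (lE M).1 m mM; rewrite ((lE m).1 m (ltnSn m)) !big_ord_recr /=.
  rewrite subnn moment_init eqxx !mulr1.
  have -> : \sum_(i < m) (l m)`_i * moment set0 S (m - i)%N =
      \sum_(i < m) (l M)`_i * moment set0 S (m - i)%N.
    by apply: eq_bigr => i _; have := ltn_ord i => im; rewrite (IH m i) ?(IH M i) //; lia.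
  by move/addrI.
exists (fun m => (l m)`_m); split=> m; last exact: (lE m).2.
rewrite (lE m).1 //; apply: eq_bigr => j _.
by rewrite uniq // -ltnS.
Qed.

End HamiltonianTerms.

(** * Real power series *)

Lemma cvg_sumr (K : numFieldType) (V : normedModType K) (T I : Type)
    (F : set_system T) (FF : Filter F) (r : seq I) (P : pred I)
    (f : I -> T -> V) (l : I -> V) :
  (forall i, P i -> f i x @[x --> F] --> l i) ->
  \sum_(i <- r | P i) f i x @[x --> F] --> \sum_(i <- r | P i) l i.
Proof.
move=> fl; elim: r => [|i r IH].
  by rewrite big_nil; under eq_fun do rewrite big_nil; exact: cvg_cst.
rewrite big_cons; under eq_fun do rewrite big_cons.
by case: ifPn => // Pi; apply: cvgD => //; exact: fl.
Qed.

Section PowerSeries.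
Variable R : realType.
Implicit Types (a b u : nat -> R) (K q r s t : R).

Lemma is_cvg_series_geometric_bound u K q : 0 <= q -> q < 1 ->
  (forall k, `|u k| <= K * q ^+ k) -> cvgn (series u).
Proof.
move=> q0 q1 uK; apply: normed_cvg; apply: (@series_le_cvg _ _ (geometric K q)).
- by move=> n; exact: normr_ge0.
- by move=> n; rewrite /geometric /=; apply: le_trans (uK n).
- exact: uK.
- by apply: is_cvg_geometric_series; rewrite ger0_norm.
Qed.

Lemma geometric_sum_le K q N M : 0 <= K -> 0 <= q -> q < 1 -> (N <= M)%N ->
  \sum_(N <= k < M) K * q ^+ k <= K * q ^+ N / (1 - q).
Proof.
move=> K0 q0 q1 NM; rewrite -mulr_sumr -mulrA ler_wpM2l //.
rewrite ler_pdivlMr ?subr_gt0 //.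
elim: M NM => [|M IH]; first by rewrite leqn0 => /eqP ->; rewrite big_nil mul0r exprn_ge0.
rewrite leq_eqVlt => /orP[/eqP ->|NM]; first by rewrite big_geq // mul0r exprn_ge0.
suff : (\sum_(N <= k < M.+1) q ^+ k) * (1 - q) = q ^+ N - q ^+ M.+1.
  by move=> ->; rewrite lerBlDr lerDl exprn_ge0.
elim: M NM {IH} => [|M IH] NM.
  by move: NM; rewrite ltnS leqn0 => /eqP ->; rewrite big_nat1 !expr0 expr1 mul1r.
move: NM; rewrite ltnS leq_eqVlt => /orP[/eqP ->|NM].
  by rewrite big_nat1 mulrBr mulr1 -exprSr.
rewrite big_nat_recr ?mulrDl ?IH //=; last by rewrite ltnW.
by rewrite mulrBr mulr1 -exprSr addrA subrK.
Qed.

Lemma series_bound u K q N : 0 <= K -> 0 <= q -> q < 1 ->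
  (forall k, `|u k| <= K * q ^+ k) -> `|series u N| <= K / (1 - q).
Proof.
move=> K0 q0 q1 uK; rewrite /series /=; apply: le_trans (ler_norm_sum _ _ _) _.
apply: le_trans (ler_sum _ (fun i _ => uK i)) _.
by have := geometric_sum_le K0 q0 q1 (leq0n N); rewrite expr0 mulr1.
Qed.

Lemma series_tail_le u K q N : 0 <= K -> 0 <= q -> q < 1 ->
  (forall k, `|u k| <= K * q ^+ k) ->
  `|limn (series u) - series u N| <= K * q ^+ N / (1 - q).
Proof.
move=> K0 q0 q1 uK.
have cu : series u @ \oo --> limn (series u).
  exact: is_cvg_series_geometric_bound uK.
have cd : `|series u n - series u N| @[n --> \oo] --> `|limn (series u) - series u N|.
  by apply: cvg_norm; apply: cvgB => //; exact: cvg_cst.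
rewrite -(cvg_lim _ cd) //; apply: limr_le; first exact: cvgP cd.
near=> n; have Nn : (N <= n)%N by near: n; exact: nbhs_infty_ge.
rewrite sub_series_geq //; apply: le_trans (ler_norm_sum _ _ _) _.
apply: le_trans (ler_sum _ (fun i _ => uK i)) _.
exact: geometric_sum_le.
Unshelve. all: by end_near. Qed.

(** Dominated convergence for series: both geometric tails are below e/4 past some N, and the
    finitely many terms before N converge one by one. *)
Lemma tannery (x : nat -> nat -> R) (y : nat -> R) K q : 0 <= K -> 0 <= q -> q < 1 ->
  (forall n k, `|x n k| <= K * q ^+ k) ->
  (forall k, x n k @[n --> \oo] --> y k) ->
  (forall k, `|y k| <= K * q ^+ k) /\
  limn (series (x n)) @[n --> \oo] --> limn (series y).
Proof.
move=> K0 q0 q1 xK xy.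
have yK k : `|y k| <= K * q ^+ k.
  have cd : `|x n k| @[n --> \oo] --> `|y k| by exact: cvg_norm (xy k).
  rewrite -(cvg_lim _ cd) //; apply: limr_le; first exact: cvgP cd.
  by near=> n; exact: xK.
split=> //; apply/cvgrPdist_le => e e0.
have tail0 : K * q ^+ N / (1 - q) @[N --> \oo] --> (0 : R).
  rewrite -[0](mul0r ((1 - q)^-1)); apply: cvgMr_tmp.
  rewrite -[0](mulr0 K); apply: cvgMl_tmp; apply: cvg_expr.
  by rewrite ger0_norm.
have e4 : 0 < e / 4 by rewrite divr_gt0.
have [N _ /(_ N (leqnn N)) NE] := (cvgr0Pnorm_le _).1 tail0 _ e4.
have fin : \sum_(0 <= k < N) `|x n k - y k| @[n --> \oo] --> (0 : R).
  suff : \sum_(0 <= k < N) `|x n k - y k| @[n --> \oo] -->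
      \sum_(0 <= k < N) (0 : R) by rewrite big1.
  apply: cvg_sumr => k _.
  have : `|x n k - y k| @[n --> \oo] --> `|y k - y k|.
    by apply: cvg_norm; apply: cvgB; [exact: xy | exact: cvg_cst].
  by rewrite subrr normr0.
near=> n.
have Hn : \sum_(0 <= k < N) `|x n k - y k| <= e / 2.
  rewrite -[leLHS]ger0_norm ?sumr_ge0 //; near: n.
  by apply: (cvgr0Pnorm_le _).1 fin _ _; rewrite divr_gt0.
have t1 := series_tail_le N K0 q0 q1 (xK n).
have t2 := series_tail_le N K0 q0 q1 yK.
have q4 : K * q ^+ N / (1 - q) <= e / 4 by apply: le_trans (ler_norm _) NE.
have d : `|series (x n) N - series y N| <= e / 2.
  by apply: le_trans Hn; rewrite /series /= -sumrB; exact: ler_norm_sum.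
move: t1 t2 d; rewrite !ler_norml; lra.
Unshelve. all: by end_near. Qed.

Definition psum a t := limn (pseries a t).

(** A Cauchy estimate, used in place of a radius of convergence because it can hold uniformly in a
    family and survives limits. *)
Definition coef_bound a r K := forall m, `|a m| * r ^+ m <= K.

Lemma coef_bound_ge0 a r K : 0 < r -> coef_bound a r K -> 0 <= K.
Proof. by move=> r0 /(_ 0%N); apply: le_trans; rewrite mulr_ge0 // exprn_ge0 // ltW. Qed.

Lemma coef_bound_term a r K t k : 0 < r -> coef_bound a r K ->
  `|a k * t ^+ k| <= K * (`|t| / r) ^+ k.
Proof.
move=> r0 aK; rewrite expr_div_n mulrA ler_pdivlMr ?exprn_gt0 // normrM normrX.
by rewrite mulrAC ler_wpM2r ?exprn_ge0.
Qed.

Lemma ratio_lt1 r t : 0 < r -> `|t| < r -> 0 <= `|t| / r /\ `|t| / r < 1.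
Proof. by move=> r0 tr; rewrite divr_ge0 ?(ltW r0) // ltr_pdivrMr // mul1r. Qed.

Lemma cvg_psum a r K t : 0 < r -> coef_bound a r K -> `|t| < r ->
  pseries a t @ \oo --> psum a t.
Proof.
move=> r0 aK tr; have [q0 q1] := ratio_lt1 r0 tr.
by apply: (is_cvg_series_geometric_bound q0 q1) => k; exact: coef_bound_term.
Qed.

(** Bernoulli's inequality for r/s = 1 + dl lets (r/s)^m absorb the factor m + 1 of the
    derivative. *)
Lemma coef_bound_diffs a r K s : 0 < s -> s < r -> coef_bound a r K ->
  exists K', coef_bound (pseries_diffs a) s K'.
Proof.
move=> s0 sr aK; have r0 := lt_trans s0 sr.
pose dl := r / s - 1; have dl0 : 0 < dl by rewrite subr_gt0 ltr_pdivlMr // mul1r.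
have K0 := coef_bound_ge0 r0 aK.
have rsE : r / s = 1 + dl by rewrite /dl addrC subrK.
exists (K / r * (1 + dl^-1)) => m.
have bern : 1 + m%:R * dl <= (r / s) ^+ m.
  elim: m => [|m IH]; first by rewrite mul0r addr0.
  rewrite exprS; apply: le_trans (_ : (1 + dl) * (1 + m%:R * dl) <= _); last first.
    by rewrite -rsE ler_wpM2l // divr_ge0 // ltW.
  have : 0 <= m%:R * dl * dl by rewrite !mulr_ge0 // ltW.
  by rewrite -natr1; lra.
have step : m.+1%:R * s ^+ m <= (1 + dl^-1) * r ^+ m.
  have -> : r ^+ m = (r / s) ^+ m * s ^+ m.
    by rewrite -exprMn divfK // gt_eqF.
  rewrite mulrA ler_wpM2r ?exprn_ge0 ?(ltW s0) //.
  apply: le_trans (ler_wpM2l _ bern); last by rewrite addr_ge0 // invr_ge0 ltW.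
  have -> : (1 + dl^-1) * (1 + m%:R * dl) = 1 + dl^-1 + m%:R * dl + m%:R.
    by field; rewrite gt_eqF.
  have : 0 <= dl^-1 by rewrite invr_ge0 ltW.
  have : 0 <= m%:R * dl by rewrite mulr_ge0 // ltW.
  by rewrite -natr1; lra.
have aE : `|a m.+1| * r ^+ m <= K / r by rewrite ler_pdivlMr // -mulrA -exprSr.
rewrite /pseries_diffs normrM normr_nat [_%:R * _]mulrC -[_ * _ * s ^+ m]mulrA.
apply: (le_trans (ler_wpM2l (normr_ge0 _) step)).
rewrite mulrCA mulrC ler_wpM2r // addr_ge0 // invr_ge0 ltW //.
Qed.

Lemma is_derive_psum a r K t : 0 < r -> coef_bound a r K -> `|t| < r ->
  is_derive t (1 : R) (psum a) (psum (pseries_diffs a) t).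
Proof.
move=> r0 aK tr.
(* Each formal derivative costs some radius: the first is bounded at r3, the second at r2, and all
   three series converge at r1 > |t|, as [pseries_snd_diffs] asks. *)
have [r1 [r2 [r3 [tr1 r12 r23 r3r]]]] : exists r1 r2 r3 : R,
    [/\ `|t| < r1, r1 < r2, r2 < r3 & r3 < r].
  exists ((3 * `|t| + r) / 4), ((2 * `|t| + 2 * r) / 4), ((`|t| + 3 * r) / 4).
  by split; lra.
have r1p : 0 < r1 by apply: le_lt_trans tr1.
have r2p := lt_trans r1p r12; have r3p := lt_trans r2p r23.
have [K1 dK] := coef_bound_diffs r3p r3r aK.
have [K2 ddK] := coef_bound_diffs r2p r23 dK.
have nr1 : `|r1| = r1 by rewrite ger0_norm // ltW.
have := @pseries_snd_diffs _ a r1 t; rewrite nr1 => D.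
apply: D => //.
- apply: cvgP; apply: (cvg_psum r0 aK).
  by rewrite nr1; apply: (lt_trans r12); apply: (lt_trans r23).
- by apply: cvgP; apply: (cvg_psum r3p dK); rewrite nr1 (lt_trans r12).
- by apply: cvgP; apply: (cvg_psum r2p ddK); rewrite nr1.
Qed.

Definition cauchy_product a b m := \sum_(j < m.+1) a j * b (m - j)%N.

(** The M-th partial sum is the sum over j < M of a_j t^j times the partial sum of length M - j of
    b; [tannery] takes M to infinity. *)
Lemma cvg_psum_product a b r K K' t : 0 < r -> coef_bound a r K ->
  coef_bound b r K' -> `|t| < r ->
  pseries (cauchy_product a b) t @ \oo --> psum a t * psum b t.
Proof.
move=> r0 aK bK tr; have [q0 q1] := ratio_lt1 r0 tr.
have K0 := coef_bound_ge0 r0 aK; have K0' := coef_bound_ge0 r0 bK.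
set q := `|t| / r in q0 q1.
pose x M j := if (j < M)%N then a j * t ^+ j * pseries b t (M - j)%N else 0.
pose KK := K * (K' / (1 - q)).
have KK0 : 0 <= KK by rewrite mulr_ge0 // divr_ge0 // subr_ge0 ltW.
have bps N : `|pseries b t N| <= K' / (1 - q).
  by apply: series_bound => // i; exact: coef_bound_term.
have xK M j : `|x M j| <= KK * q ^+ j.
  rewrite /x; case: ifP => _; last by rewrite normr0 mulr_ge0 // exprn_ge0.
  rewrite normrM /KK mulrAC ler_pM //; exact: coef_bound_term.
have xy j : x M j @[M --> \oo] --> a j * t ^+ j * psum b t.
  have cb := cvg_psum r0 bK tr.
  apply: (cvg_trans (G := a j * t ^+ j * pseries b t (M - j)%N @[M --> \oo])).
    apply: near_eq_cvg; near=> M; rewrite /x ifT //.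
    by near: M; exact: nbhs_infty_gt.
  apply: cvgMl_tmp.
  exact: (@cvg_comp _ _ _ (subn^~ j) (pseries b t) _ _ _ (cvg_subnr j) cb).
have [yK lx] := tannery KK0 q0 q1 xK xy.
have yE : limn (series (fun j => a j * t ^+ j * psum b t)) = psum a t * psum b t.
  apply/cvg_lim => //; have ca := cvg_psum r0 aK tr.
  rewrite (_ : series _ = fun n => pseries a t n * psum b t).
    by apply: cvgMr_tmp.
  by apply/funext => n; rewrite /series /pseries /= mulr_suml.
rewrite yE in lx.
rewrite (_ : pseries (cauchy_product a b) t = fun M => limn (series (x M))) //.
apply/funext => M; apply/esym/cvg_lim => //.
apply: cvg_near_cst; near=> N.
have MN : (M <= N)%N by near: N; exact: nbhs_infty_ge.
rewrite /series /= (big_cat_nat (n := M)) //= [X in _ + X]big_nat_cond.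
rewrite [X in _ + X]big1 ?addr0; last first.
  by move=> i; rewrite andbT => /andP[Mi _]; rewrite /x ltnNge Mi.
rewrite /pseries /series /=.
transitivity (\sum_(0 <= j < M) \sum_(0 <= m < M | (j <= m)%N) a j * b (m - j)%N * t ^+ m).
  rewrite big_nat_cond [RHS]big_nat_cond; apply: eq_bigr => j; rewrite andbT => /andP[_ jM].
  rewrite /x jM /pseries /series /= mulr_sumr.
  rewrite [RHS](big_cat_nat (n := j)) //=; last exact: ltnW.
  rewrite [X in _ = X + _]big_nat_cond [X in _ = X + _]big_pred0 ?add0r; last first.
    by move=> i; apply/negbTE; lia.
  have shift (F : nat -> R) :
      \sum_(j <= m < M) F m = \sum_(0 <= i < M - j) F (i + j)%N.
    by rewrite -{1}[j]add0n big_addn.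
  rewrite [RHS]big_mkcond /= shift; apply: eq_bigr => i _.
  by rewrite addnK leq_addl exprD; ring.
rewrite (exchange_big_dep_nat xpredT) //= big_nat_cond [RHS]big_nat_cond.
apply: eq_bigr => m; rewrite andbT => /andP[_ mM].
rewrite /cauchy_product -(big_mkord xpredT (fun j => a j * b (m - j)%N)) mulr_suml.
rewrite (big_cat_nat (n := m.+1)) //=.
rewrite [X in _ + X]big_nat_cond [X in _ + X]big_pred0 ?addr0; last first.
  by move=> i; apply/negbTE; lia.
rewrite big_nat_cond [RHS]big_nat_cond; apply: eq_bigl => i.
by rewrite ltnS; lia.
Unshelve. all: by end_near. Qed.

End PowerSeries.

(** * Recentring a power series, and limits of power series *)

Section PowerSeriesLimits.
Variable R : realType.
Implicit Types (a b c u : nat -> R) (K q r s t : R).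

Lemma binomial_term_le (x y : R) m k : 0 <= x -> 0 <= y ->
  'C(m, k)%:R * x ^+ (m - k) * y ^+ k <= (x + y) ^+ m.
Proof.
move=> x0 y0; have [km|mk] := leqP k m; last first.
  by rewrite bin_small // !mul0r exprn_ge0 // addr_ge0.
rewrite exprDn (bigD1 (Ordinal (km : (k < m.+1)%N))) //= -[leLHS]addr0 lerD //.
  by rewrite -[leRHS]mulr_natl mulrA.
by apply: sumr_ge0 => i _; rewrite mulrn_wge0 // mulr_ge0 // exprn_ge0.
Qed.

(** Expand (t0 + h)^m and sum over m first. As s1 = |t0| + sg, [binomial_term_le] bounds C(m, k)
    |t0|^(m-k) sg^k by s1^m, and s1 < r makes the sum over m geometric. *)
Lemma psum_recenter c r K t0 : 0 < r -> coef_bound c r K -> `|t0| < r ->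
  exists b rho, 0 < rho /\
    forall s, `|s - t0| < rho -> pseries b (s - t0) @ \oo --> psum c s.
Proof.
move=> r0 cK t0r; have K0 := coef_bound_ge0 r0 cK.
pose s1 := (`|t0| + r) / 2; pose sg := s1 - `|t0|.
have sg0 : 0 < sg by rewrite /sg /s1; lra.
have s1r : s1 < r by rewrite /s1; lra.
have s10 : 0 < s1 by have := normr_ge0 t0; rewrite /s1; lra.
pose q := s1 / r; have q0 : 0 <= q by rewrite divr_ge0 // ltW.
have q1 : q < 1 by rewrite ltr_pdivrMr // mul1r.
pose u k m := 'C(m, k)%:R * c m * t0 ^+ (m - k).
have uK k m : `|u k m| <= K / sg ^+ k * q ^+ m.
  rewrite mulrAC ler_pdivlMr ?exprn_gt0 // /u !normrM normr_nat normrX.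
  have -> : 'C(m, k)%:R * `|c m| * `|t0| ^+ (m - k) * sg ^+ k =
      `|c m| * ('C(m, k)%:R * `|t0| ^+ (m - k) * sg ^+ k) by ring.
  apply: le_trans (_ : `|c m| * s1 ^+ m <= _).
    rewrite ler_wpM2l //; have -> : s1 = `|t0| + sg by rewrite /sg addrC subrK.
    by apply: binomial_term_le => //; exact: ltW.
  rewrite /q -/(s1 / r) [(s1 / r) ^+ m]expr_div_n mulrA ler_pdivlMr ?exprn_gt0 //.
  by rewrite mulrAC
    ler_wpM2r // exprn_ge0 // ltW.
have Kk0 k : 0 <= K / sg ^+ k by rewrite divr_ge0 // exprn_ge0 // ltW.
exists (fun k => limn (series (u k))), sg; split=> // s.
set h := s - t0 => hsg.
(* Summed over k, these terms give exactly the M-th partial sum of the series of c at s, because u k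
   m = 0 for k > m. *)
pose x M k := series (u k) M * h ^+ k.
have [p0 p1] := ratio_lt1 sg0 hsg.
have KK0 : 0 <= K / (1 - q) by rewrite divr_ge0 // subr_ge0 ltW.
have xK M k : `|x M k| <= K / (1 - q) * (`|h| / sg) ^+ k.
  rewrite /x normrM normrX expr_div_n mulrA ler_pdivlMr ?exprn_gt0 // mulrAC.
  rewrite ler_wpM2r ?exprn_ge0 // -ler_pdivlMr ?exprn_gt0 // mulrAC.
  exact: series_bound.
have xy k : x M k @[M --> \oo] --> limn (series (u k)) * h ^+ k.
  by apply: cvgMr_tmp; exact: is_cvg_series_geometric_bound (uK k).
have [yK lx] := tannery KK0 p0 p1 xK xy.
have cy := is_cvg_series_geometric_bound p0 p1 yK.
suff E : limn (series (fun k => limn (series (u k)) * h ^+ k)) = psum c s.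
  by rewrite -E; exact: cy.
apply: (@cvg_unique _ _ (limn (series (x M)) @[M --> \oo])) => //.
have sr : `|s| < r.
  have -> : s = t0 + h by rewrite addrC subrK.
  by apply: le_lt_trans (ler_normD _ _) _; move: hsg; rewrite /sg; lra.
rewrite (_ : (fun M => limn (series (x M))) = pseries c s).
  exact: cvg_psum r0 cK sr.
apply/funext => M; apply/cvg_lim => //; apply: cvg_near_cst; near=> N.
have MN : (M <= N)%N by near: N; exact: nbhs_infty_ge.
rewrite /series /x /= /series /=; under eq_bigr do rewrite mulr_suml.
rewrite exchange_big /= /pseries /series /= big_nat_cond [RHS]big_nat_cond.
apply: eq_bigr => m; rewrite andbT => /andP[_ mM].
have {1}-> : s = t0 + h by rewrite addrC subrK.
rewrite exprDn mulr_sumr (big_cat_nat (n := m.+1)) //=; last exact: leq_trans MN.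
rewrite [X in _ + X]big_nat_cond [X in _ + X]big1 ?addr0; last first.
  by move=> i; rewrite andbT => /andP[mi _]; rewrite /u bin_small ?mul0r.
rewrite big_mkord; apply: eq_bigr => i _.
by rewrite /u -mulr_natl; ring.
Unshelve. all: by end_near. Qed.

Lemma is_cvg_uniform_approx u :
  (forall e : R, 0 < e -> exists2 v : nat -> R, cvgn v & forall n, `|u n - v n| <= e) ->
  cvgn u.
Proof.
move=> H; apply/cauchy_cvgP/cauchy_exP => e e0.
have [v cv uv] := H (e / 2) (divr_gt0 e0 (ltr0n _ 2)).
exists (limn v).
suff : \forall n \near \oo, ball (limn v) e (u n) by [].
near=> n; rewrite /ball /= /ball_.
have h1 := uv n; have h2 : `|limn v - v n| < e / 2.
  by near: n; apply: (cvgrPdist_lt _ _).1 => //; rewrite divr_gt0.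
by move: h1 h2; rewrite ler_norml !ltr_norml; lra.
Unshelve. all: by end_near. Qed.

(** Vitali's theorem by elementary means. Inductively, subtract the terms below m and divide by t^m:
    the result differs from c n m by O(t) uniformly in n, so c n m is a uniform limit of convergent
    sequences in n. *)
Lemma psum_limit (c : nat -> nat -> R) (G : R -> R) r K : 0 < r ->
  (forall n, coef_bound (c n) r K) ->
  (forall t, `|t| < r -> psum (c n) t @[n --> \oo] --> G t) ->
  exists2 l, coef_bound l r K & forall t, `|t| < r -> psum l t = G t.
Proof.
move=> r0 cK cG; have K0 := coef_bound_ge0 r0 (cK 0%N).
have ccvg m : cvgn (c ^~ m).
  have [j] := ubnP m; elim: j m => // j IH m mj; apply: is_cvg_uniform_approx => e e0.
  (* The bound r/2 makes the geometric factor at most 2, and the other one makes the error at most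
     e; the added 1 keeps the denominator positive when K = 0. *)
  pose t := Num.min (r / 2) (e * r ^+ m.+1 / (2 * K + 1)).
  have K1 : 0 < 2 * K + 1 by lra.
  have t0 : 0 < t by rewrite lt_min !divr_gt0 // mulr_gt0 // exprn_gt0.
  have tr2 : t <= r / 2 by rewrite ge_min lexx.
  have te : t <= e * r ^+ m.+1 / (2 * K + 1) by rewrite ge_min lexx orbT.
  have nt : `|t| = t by rewrite ger0_norm // ltW.
  have tr : `|t| < r by rewrite nt; lra.
  have [q0 q1] := ratio_lt1 r0 tr.
  have q2 : `|t| / r <= 1 / 2 by rewrite ler_pdivrMr // nt; lra.
  exists (fun n => (psum (c n) t - \sum_(0 <= i < m) c n i * t ^+ i) / t ^+ m).
    apply: is_cvgMr_tmp; apply: is_cvgB; first by apply: cvgP; exact: cG.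
    under eq_fun do rewrite big_nat_cond.
    apply: cvgP; apply: (@cvg_sumr _ _ _ _ _ _ _ _ _
      (fun i => limn (c ^~ i) * t ^+ i)) => i; rewrite andbT => /andP[_ im].
    by apply: cvgMr_tmp; apply: IH; exact: leq_trans im mj.
  move=> n; rewrite -(ler_pM2r (exprn_gt0 m t0)).
  rewrite -{2}[t ^+ m]ger0_norm ?exprn_ge0 ?(ltW t0) // -normrM mulrBl.
  rewrite divfK ?expf_neq0 ?gt_eqF //.
  have h : `|psum (c n) t - \sum_(0 <= k < m.+1) c n k * t ^+ k| <=
      K * (`|t| / r) ^+ m.+1 / (1 - `|t| / r).
    exact: (series_tail_le m.+1 K0 q0 q1
      (fun k => coef_bound_term t k r0 (cK n))).
  rewrite big_nat_recr //= in h.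
  rewrite distrC; set P := psum _ _ in h *; set Q := \sum_(_ <= _ < _) _ in h *.
  have -> : P - Q - c n m * t ^+ m = P - (Q + c n m * t ^+ m) by ring.
  apply: le_trans h _.
  apply: le_trans (_ : K * (`|t| / r) ^+ m.+1 * 2 <= _).
    rewrite ler_wpM2l // ?mulr_ge0 ?exprn_ge0 //.
    by rewrite -div1r ler_pdivrMr; lra.
  rewrite nt expr_div_n mulrA mulrAC ler_pdivrMr ?exprn_gt0 //.
  rewrite exprS; have tm : 0 <= t ^+ m by rewrite exprn_ge0 // ltW.
  have te' : t * (2 * K + 1) <= e * r ^+ m.+1 by rewrite -ler_pdivlMr.
  have : t * (2 * K) <= e * r ^+ m.+1 by lra.
  move/(ler_wpM2r tm); rewrite exprS; lra.
have lK : coef_bound (fun m => limn (c ^~ m)) r K.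
  move=> m; have cd : `|c n m| * r ^+ m @[n --> \oo] --> `|limn (c ^~ m)| * r ^+ m.
    by apply: cvgMr_tmp; apply: cvg_norm; exact: ccvg.
  rewrite -(cvg_lim _ cd) //; apply: limr_le; first exact: cvgP cd.
  by near=> n; exact: cK.
exists (fun m => limn (c ^~ m)) => // t tr.
have [q0 q1] := ratio_lt1 r0 tr.
have [] := @tannery _ (fun n k => c n k * t ^+ k) (fun k => limn (c ^~ k) * t ^+ k)
  K (`|t| / r) K0 q0 q1.
- by move=> n k; exact: coef_bound_term.
- by move=> k; apply: cvgMr_tmp; exact: ccvg.
by move=> _ H; rewrite -(cvg_lim _ (cG t tr)) //; apply/esym/cvg_lim.
Unshelve. all: by end_near. Qed.

End PowerSeriesLimits.

(** * Complex-valued series of a real variable *)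

Section ComplexSeries.
Variable R : realType.
Implicit Types (z w l : R[i]) (r s t x : R).
Local Notation Re := (@complex.Re R).
Local Notation Im := (@complex.Im R).

Lemma cabs_sqrt z : cabs z = Num.sqrt (Re z ^+ 2 + Im z ^+ 2).
Proof. by rewrite /cabs normc_def. Qed.

Lemma Re_le_cabs z : `|Re z| <= cabs z.
Proof. by rewrite cabs_sqrt -sqrtr_sqr ler_wsqrtr // lerDl sqr_ge0. Qed.

Lemma Im_le_cabs z : `|Im z| <= cabs z.
Proof. by rewrite cabs_sqrt -sqrtr_sqr ler_wsqrtr // lerDr sqr_ge0. Qed.

Lemma cabs_le_ReIm z : cabs z <= `|Re z| + `|Im z|.
Proof.
rewrite cabs_sqrt -[leRHS]ger0_norm ?addr_ge0 // -sqrtr_sqr ler_wsqrtr //.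
rewrite sqrrD !real_normK ?num_real // lerD2r lerDl mulrn_wge0 //.
Qed.

Lemma cReD z w : Re (z + w) = Re z + Re w. Proof. by case: z; case: w. Qed.
Lemma cImD z w : Im (z + w) = Im z + Im w. Proof. by case: z; case: w. Qed.
Lemma cReB z w : Re (z - w) = Re z - Re w. Proof. by case: z; case: w. Qed.
Lemma cImB z w : Im (z - w) = Im z - Im w. Proof. by case: z; case: w. Qed.
Lemma cReM z w : Re (z * w) = Re z * Re w - Im z * Im w.
Proof. by case: z; case: w. Qed.
Lemma cImM z w : Im (z * w) = Re z * Im w + Im z * Re w.
Proof. by case: z; case: w. Qed.

Lemma cRe_sum I (P : pred I) (e : seq I) (F : I -> R[i]) :
  Re (\sum_(i <- e | P i) F i) = \sum_(i <- e | P i) Re (F i).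
Proof. by apply: (big_morph Re cReD). Qed.

Lemma cIm_sum I (P : pred I) (e : seq I) (F : I -> R[i]) :
  Im (\sum_(i <- e | P i) F i) = \sum_(i <- e | P i) Im (F i).
Proof. by apply: (big_morph Im cImD). Qed.

Lemma cReMr z x : Re (z * x%:C) = Re z * x.
Proof. by rewrite cReM /= mulr0 subr0. Qed.

Lemma cImMr z x : Im (z * x%:C) = Im z * x.
Proof. by rewrite cImM /= mulr0 add0r. Qed.

Lemma cvg_ReIm (u : nat -> R[i]) l : u @ \oo --> l <->
  (Re (u n) @[n --> \oo] --> Re l) /\ (Im (u n) @[n --> \oo] --> Im l).
Proof.
split=> [/cvgrPdist_lt ul|[/cvgrPdist_lt uR /cvgrPdist_lt uI]].
  split; apply/cvgrPdist_lt => e e0; have := ul e%:C; rewrite ltcR => /(_ e0);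
    apply: filterS => n; rewrite cabsE ltcR => h; apply: le_lt_trans h.
  - by rewrite -cReB; exact: Re_le_cabs.
  - by rewrite -cImB; exact: Im_le_cabs.
apply/cvgrPdist_lt => e e0.
have eR : e = (Re e)%:C by rewrite RRe_real // gtr0_real.
rewrite eR ltcR in e0; have e2 : 0 < Re e / 2 by rewrite divr_gt0.
near=> n; rewrite eR cabsE ltcR.
apply: le_lt_trans (cabs_le_ReIm _) _; rewrite cReB cImB [ltRHS]splitr.
apply: ltrD; near: n; [exact: uR | exact: uI].
Unshelve. all: by end_near. Qed.

Lemma cvg_cseries (a : nat -> R[i]) x l :
  series (fun k => a k * x%:C ^+ k) @ \oo --> l <->
  (pseries (Re \o a) x @ \oo --> Re l) /\ (pseries (Im \o a) x @ \oo --> Im l).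
Proof.
rewrite cvg_ReIm.
have -> : (fun n => Re (series (fun k => a k * x%:C ^+ k) n)) = pseries (Re \o a) x.
  apply/funext => n; rewrite /pseries /series /= cRe_sum.
  by apply: eq_bigr => i _; rewrite -rmorphXn cReMr.
have -> // : (fun n => Im (series (fun k => a k * x%:C ^+ k) n)) = pseries (Im \o a) x.
apply/funext => n; rewrite /pseries /series /= cIm_sum.
by apply: eq_bigr => i _; rewrite -rmorphXn cImMr.
Qed.

Lemma analytic_at_ReIm (f : R -> R[i]) t :
  (exists b rho, 0 < rho /\
    forall s, `|s - t| < rho -> pseries b (s - t) @ \oo --> Re (f s)) ->
  (exists b rho, 0 < rho /\
    forall s, `|s - t| < rho -> pseries b (s - t) @ \oo --> Im (f s)) ->
  analytic_at f t.
Proof.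
move=> [b [r1 [r10 H1]]] [c [r2 [r20 H2]]].
exists (fun k => b k +i* c k), (Num.min r1 r2); split; first by rewrite lt_min r10.
move=> s; rewrite lt_min => /andP[s1 s2]; apply/cvg_cseries.
by split; [exact: H1 | exact: H2].
Qed.

(** Convergence at the single point t + rho/2 bounds the terms there; this gives a [coef_bound],
    hence termwise differentiation at t. *)
Lemma pseries_derivable (b : nat -> R) (F : R -> R) t rho : 0 < rho ->
  (forall s, `|s - t| < rho -> pseries b (s - t) @ \oo --> F s) ->
  derivable F t 1.
Proof.
move=> rho0 H; pose r := rho / 2; have r0 : 0 < r by rewrite divr_gt0.
have cr : pseries b r @ \oo --> F (t + r).
  have := H (t + r); rewrite addrAC subrr add0r; apply.
  by rewrite ger0_norm ?(ltW r0) // /r; lra.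
have [M [_ Mb]] := cvg_series_bounded (cvgP _ cr).
have bK : coef_bound b r (M + 1).
  move=> m; have M1 : M < M + 1 by rewrite ltrDl.
  have := Mb _ M1 m I; rewrite /= normrM normrX.
  by rewrite [`|r|]ger0_norm ?(ltW r0).
have D := @is_derive_psum _ b r (M + 1) 0 r0 bK.
rewrite normr0 in D; have {}D := D r0.
have D2 : is_derive t 1 (psum b \o (fun s => s - t)) (psum (pseries_diffs b) 0 * 1).
  apply: is_derive1_comp; first by rewrite subrr.
  have := is_deriveB (is_derive_id t (1 : R)) (is_derive_cst t t (1 : R)).
  by rewrite subr0.
have E : \forall s \near t, psum b (s - t) = F s.
  near=> s; apply/cvg_lim => //; apply: H.
  rewrite distrC; near: s; exact: (cvgrPdist_lt _ _).1 (cvg_id) _ rho0.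
case: D2 => D2 _.
exact: (@near_eq_derivable _ _ _ (psum b \o (fun s => s - t)) F t 1 E D2).
Unshelve. all: by end_near. Qed.

Lemma analytic_derivable (f : R -> R[i]) t : analytic_at f t ->
  derivable (Re \o f) t 1 /\ derivable (Im \o f) t 1.
Proof.
move=> [a [r [r0 H]]]; split.
- by apply: (@pseries_derivable (Re \o a) _ _ _ r0) => s /H/cvg_cseries[].
- by apply: (@pseries_derivable (Im \o a) _ _ _ r0) => s /H/cvg_cseries[].
Qed.

Lemma derive0_cst (F : R -> R) r : 0 < r ->
  (forall t, `|t| < r -> is_derive t 1 F 0) -> forall t, `|t| < r -> F t = F 0.
Proof.
move=> r0 dF t tr.
have cF s : `|s| < r -> {for s, continuous F}.
  by move=> sr; apply/differentiable_continuous/derivable1_diffP; have [] := dF s sr.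
have seg a b : a <= b -> `|a| < r -> `|b| < r -> F b = F a.
  move=> ab ar br.
  have inab x : a <= x <= b -> `|x| < r.
    by move=> /andP[ax xb]; move: ar br; rewrite !ltr_norml; lra.
  have [||c _] := @MVT_segment _ F (fun=> 0) a b ab.
  - move=> x; rewrite in_itv /= => /andP[ax xb]; apply: dF; apply: inab.
    by rewrite !ltW.
  - apply: continuous_in_subspaceT => x; rewrite inE /= in_itv /= => h.
    by apply: cF; exact: inab.
  by rewrite mul0r => /eqP; rewrite subr_eq0 => /eqP.
have z : `|0 : R| < r by rewrite normr0.
by have [t0|t0] := leP 0 t; [exact: seg | apply/esym/seg => //; exact: ltW].
Qed.

End ComplexSeries.

(** * Logarithmic branches *)

Section LogBranch.
Variables (R : realType) (r Kf Kp : R) (f g : R -> R[i]) (fc pc : nat -> R[i]).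
Local Notation Re := (@complex.Re R).
Local Notation Im := (@complex.Im R).
Hypothesis r0 : 0 < r.
Hypothesis fcK : forall m, cabs (fc m) * r ^+ m <= Kf.
Hypothesis pcK : forall m, cabs (pc m) * r ^+ m <= Kp.
Hypothesis pc0 : pc 0%N = 0.
Hypothesis dlog : forall m, m.+1%:R * fc m.+1 =
  \sum_(j < m.+1) (j.+1%:R * pc j.+1) * fc (m - j)%N.
Hypothesis fE : forall t : R, `|t| < r ->
  series (fun k => fc k * t%:C ^+ k) @ \oo --> f t.
Hypothesis g_log : is_log_branch r f g.

Let a := Re \o fc.
Let b := Im \o fc.
Let c := Re \o pc.
Let e := Im \o pc.

Let bound_Re (h : nat -> R[i]) K :
  (forall m, cabs (h m) * r ^+ m <= K) -> coef_bound (Re \o h) r K.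
Proof.
move=> hK m; apply: le_trans (hK m); rewrite ler_wpM2r ?exprn_ge0 ?(ltW r0) //.
exact: Re_le_cabs.
Qed.

Let bound_Im (h : nat -> R[i]) K :
  (forall m, cabs (h m) * r ^+ m <= K) -> coef_bound (Im \o h) r K.
Proof.
move=> hK m; apply: le_trans (hK m); rewrite ler_wpM2r ?exprn_ge0 ?(ltW r0) //.
exact: Im_le_cabs.
Qed.

Let aK := bound_Re fcK.
Let bK := bound_Im fcK.
Let cK := bound_Re pcK.
Let eK := bound_Im pcK.

Let ReMn m z : Re (m%:R * z) = m%:R * Re z.
Proof.

by have -> : m%:R * z = z * (m%:R)%:C; [rewrite mulrC rmorph_nat|rewrite cReMr mulrC].
Qed.

Let ImMn m z : Im (m%:R * z) = m%:R * Im z.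
Proof.
by have -> : m%:R * z = z * (m%:R)%:C; [rewrite mulrC rmorph_nat|rewrite cImMr mulrC].
Qed.

Let diffs_a m : pseries_diffs a m =
  cauchy_product (pseries_diffs c) a m - cauchy_product (pseries_diffs e) b m.
Proof.
have := congr1 Re (dlog m); rewrite ReMn cRe_sum => E.
rewrite /pseries_diffs /a /= E /cauchy_product -sumrB; apply: eq_bigr => j _.
by rewrite cReM ReMn ImMn.
Qed.

Let diffs_b m : pseries_diffs b m =
  cauchy_product (pseries_diffs c) b m + cauchy_product (pseries_diffs e) a m.
Proof.
have := congr1 Im (dlog m); rewrite ImMn cIm_sum => E.
rewrite /pseries_diffs /b /= E /cauchy_product -big_split; apply: eq_bigr => j _.
by rewrite cImM ReMn ImMn.
Qed.

Let mid (t : R) : `|t| < r -> exists2 s : R, `|t| < s & 0 < s /\ s < r.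
Proof.
by move=> tr; exists ((`|t| + r) / 2); have := normr_ge0 t; lra.
Qed.

Let weaken (h : nat -> R) K (s : R) : 0 < s -> s < r -> coef_bound h r K ->
  coef_bound h s K.
Proof.
move=> s0 sr hK m; apply: le_trans (hK m).
by rewrite ler_wpM2l // lerXn2r ?nnegrE ?ltW // (lt_trans s0).
Qed.

Let psum_diffs_a t : `|t| < r -> psum (pseries_diffs a) t =
  psum (pseries_diffs c) t * psum a t - psum (pseries_diffs e) t * psum b t.
Proof.
move=> tr; have [s ts [s0 sr]] := mid tr.
have [K1 dcK] := coef_bound_diffs s0 sr cK.
have [K2 deK] := coef_bound_diffs s0 sr eK.
apply/cvg_lim => //.
rewrite (_ : pseries _ t = pseries (cauchy_product (pseries_diffs c) a) t -
  pseries (cauchy_product (pseries_diffs e) b) t).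
  apply: cvgB.
    exact: (cvg_psum_product s0 dcK (weaken s0 sr aK) ts).
  exact: (cvg_psum_product s0 deK (weaken s0 sr bK) ts).
apply/funext => n; rewrite fctE /pseries /series /= -sumrB.
by apply: eq_bigr => k _; rewrite diffs_a mulrBl.
Qed.

Let psum_diffs_b t : `|t| < r -> psum (pseries_diffs b) t =
  psum (pseries_diffs c) t * psum b t + psum (pseries_diffs e) t * psum a t.
Proof.
move=> tr; have [s ts [s0 sr]] := mid tr.
have [K1 dcK] := coef_bound_diffs s0 sr cK.
have [K2 deK] := coef_bound_diffs s0 sr eK.
apply/cvg_lim => //.
rewrite (_ : pseries _ t = pseries (cauchy_product (pseries_diffs c) b) t +
  pseries (cauchy_product (pseries_diffs e) a) t).
  apply: cvgD.
    exact: (cvg_psum_product s0 dcK (weaken s0 sr bK) ts).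
  exact: (cvg_psum_product s0 deK (weaken s0 sr aK) ts).
apply/funext => n; rewrite fctE /pseries /series /= -big_split.
by apply: eq_bigr => k _; rewrite /= diffs_b mulrDl.
Qed.

Let gr := Re \o g.
Let gi := Im \o g.

Let cexpE z : cexp z = (expR (Re z) * cos (Im z)) +i* (expR (Re z) * sin (Im z)).
Proof. by case: z => x y; rewrite /cexp /=; apply/eqP; rewrite eq_complex /= !mul0r subr0 addr0 !eqxx. Qed.

Let psum_aE t : `|t| < r -> psum a t = expR (gr t) * cos (gi t).
Proof.
move=> tr; have [_ _ /(_ t tr) E] := g_log.
by rewrite -[RHS]/(Re (_ +i* (expR (gr t) * sin (gi t)))) -cexpE E;
  apply/cvg_lim => //; have /cvg_cseries[] := fE tr.
Qed.

Let psum_bE t : `|t| < r -> psum b t = expR (gr t) * sin (gi t).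
Proof.
move=> tr; have [_ _ /(_ t tr) E] := g_log.
by rewrite -[RHS]/(Im ((expR (gr t) * cos (gi t)) +i* _)) -cexpE E;
  apply/cvg_lim => //; have /cvg_cseries[] := fE tr.
Qed.

Let near_disc (t : R) : `|t| < r -> \forall s \near t, (`|s : R| < r).
Proof.
move=> tr; have e0 : 0 < r - `|t| by rewrite subr_gt0.
near=> s; have h : `|t - s| < r - `|t|.
  near: s; exact: (cvgrPdist_lt _ _).1 (cvg_id) _ e0.
have := ler_normB t (t - s); rewrite subKr; lra.
Unshelve. all: by end_near. Qed.

(** From f = exp(g) comes f' = g' f, and the recursion [dlog] gives f' = P' f for the series P of
    [pc]. Since |f|^2 = e^(2 Re g) is positive, g' = P'. All this is done on real and imaginary
    parts. *)
Let log_deriv (t : R) : `|t| < r ->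
  is_derive t 1 gr (psum (pseries_diffs c) t) /\
  is_derive t 1 gi (psum (pseries_diffs e) t).
Proof.
move=> tr; have [_ /(_ t tr) /analytic_derivable[dr di] _] := g_log.
have Dr := derivableP dr; have Di := derivableP di.
set u := 'D_1 gr t in Dr; set v := 'D_1 gi t in Di.
have Da := is_derive_psum r0 aK tr; have Db := is_derive_psum r0 bK tr.
have De : is_derive t 1 (expR \o gr) (expR (gr t) * u) by apply: is_derive1_comp.
have Dc : is_derive t 1 (cos \o gi) (- sin (gi t) * v) by apply: is_derive1_comp.
have Ds : is_derive t 1 (sin \o gi) (cos (gi t) * v) by apply: is_derive1_comp.
have Da' : is_derive t 1 (psum a)
    (expR (gr t) * (- sin (gi t) * v) + cos (gi t) * (expR (gr t) * u)).
  apply: near_eq_is_derive (is_deriveM De Dc); near=> s.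
  rewrite psum_aE //; near: s; exact: near_disc.
have Db' : is_derive t 1 (psum b)
    (expR (gr t) * (cos (gi t) * v) + sin (gi t) * (expR (gr t) * u)).
  apply: near_eq_is_derive (is_deriveM De Ds); near=> s.
  rewrite psum_bE //; near: s; exact: near_disc.
have Ea : psum (pseries_diffs a) t = u * psum a t - v * psum b t.
  rewrite -(@derive_val _ _ _ _ _ _ _ Da) (@derive_val _ _ _ _ _ _ _ Da').
  by rewrite psum_aE // psum_bE //; ring.
have Eb : psum (pseries_diffs b) t = u * psum b t + v * psum a t.
  rewrite -(@derive_val _ _ _ _ _ _ _ Db) (@derive_val _ _ _ _ _ _ _ Db').
  by rewrite psum_aE // psum_bE //; ring.
rewrite (psum_diffs_a tr) in Ea; rewrite (psum_diffs_b tr) in Eb.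
set A := psum a t in Ea Eb; set B := psum b t in Ea Eb.
have AB : A ^+ 2 + B ^+ 2 != 0.
  have -> : A ^+ 2 + B ^+ 2 = expR (gr t) ^+ 2 * (cos (gi t) ^+ 2 + sin (gi t) ^+ 2).
    by rewrite /A /B psum_aE // psum_bE //; ring.
  by rewrite cos2Dsin2 mulr1 expf_neq0 // gt_eqF // expR_gt0.
set x := psum (pseries_diffs c) t in Ea Eb *.
set y := psum (pseries_diffs e) t in Ea Eb *.
(* (x, y) and (u, v) solve the same linear system, of determinant A^2 + B^2. *)
have -> : x = u.
  apply/eqP; rewrite -subr_eq0 -(mulIr_eq0 _ (mulIf AB)); apply/eqP.
  transitivity ((x * A - y * B) * A + (x * B + y * A) * B -
    ((u * A - v * B) * A + (u * B + v * A) * B)); first by ring.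
  by rewrite Ea Eb subrr.
have -> : y = v.
  apply/eqP; rewrite -subr_eq0 -(mulIr_eq0 _ (mulIf AB)); apply/eqP.
  transitivity ((x * B + y * A) * A - (x * A - y * B) * B -
    ((u * B + v * A) * A - (u * A - v * B) * B)); first by ring.
  by rewrite Ea Eb subrr.
by [].
Unshelve. all: by end_near. Qed.

Lemma psum0 (h : nat -> R) : psum h 0 = h 0%N.
Proof.
apply/cvg_lim => //; apply: cvg_near_cst; near=> n.
have n0 : (0 < n)%N by near: n; exact: nbhs_infty_gt.
rewrite /pseries /series /= -(prednK n0) big_nat_recl //= expr0 mulr1.
by rewrite big1 ?addr0 // => i _; rewrite exprS mul0r mulr0.
Unshelve. all: by end_near. Qed.

(** The branch and the series have equal derivatives on the interval and both vanish at 0. *)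
Lemma log_branch_psum (t : R) : `|t| < r ->
  Re (g t) = psum (Re \o pc) t /\ Im (g t) = psum (Im \o pc) t.
Proof.
move=> tr; have [g0 _ _] := g_log.
have Er := @derive0_cst _ (gr - psum c) r r0; have Ei := @derive0_cst _ (gi - psum e) r r0.
split; apply/eqP; rewrite -subr_eq0; apply/eqP.
- transitivity ((gr - psum c) 0); last first.
    by rewrite !fctE psum0 /gr /c /= g0 pc0 subrr.
  apply: Er => // s sr; have [D _] := log_deriv sr.
  by have := is_deriveB D (is_derive_psum r0 cK sr); rewrite subrr.
- transitivity ((gi - psum e) 0); last first.
    by rewrite !fctE psum0 /gi /e /= g0 pc0 subrr.
  apply: Ei => // s sr; have [_ D] := log_deriv sr.
  by have := is_deriveB D (is_derive_psum r0 eK sr); rewrite subrr.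
Qed.

End LogBranch.

(** * The Loschmidt amplitude *)

Lemma exp_term_le (R : realType) (r : R) s m : 0 <= r ->
  (s ^ m)%N%:R / m`!%:R * r ^+ m <= expR (r * s%:R).
Proof.
move=> r0; have := @sum_nb_words_le R r 0 s m.+1 r0.
rewrite mulr1 big_ord_recr /= nb_words0 mulrAC; apply: le_trans.
rewrite lerDr sumr_ge0 // => i _.
by rewrite divr_ge0 // mulr_ge0 // exprn_ge0.
Qed.

Section MatrixExponential.
Variables (R : realType) (N : nat).
Implicit Types A B : 'M[R[i]]_N.

Lemma cvg_entries (A_ : nat -> 'M[R[i]]_N) B :
  (forall i j, A_ n i j @[n --> \oo] --> B i j) -> A_ @ \oo --> B.
Proof.
move=> AB; apply/cvg_mx_entourageP => E entE.
have H i j : \forall n \near \oo, (B i j, A_ n i j) \in E.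
  have /cvg_entourageP /(_ _ entE) := AB i j.
  by move=> h; near=> n; rewrite inE; near: n; exact: h.
suff : \forall n \near \oo, forall i j, (B i j, A_ n i j) \in E by [].
apply: (@filter_forall _ _ (fun i n => forall j, (B i j, A_ n i j) \in E)) => i.
exact: (@filter_forall _ _ (fun j n => (B i j, A_ n i j) \in E)).
Unshelve. all: by end_near. Qed.

Lemma cvg_expmx A s : (forall k, opbound (s ^ k)%N%:R (A ^+ k)) ->
  series (fun k => (k`!%:R)^-1 *: A ^+ k) @ \oo --> expmx A.
Proof.
move=> As; pose e i j k := (k`!%:R)^-1 * (A ^+ k) i j.
(* A bound at radius 2 leaves room to evaluate the series at 1. *)
have eK i j k : cabs (e i j k) * 2 ^+ k <= expR (2 * s%:R).
  apply: le_trans (exp_term_le s k (ler0n R 2)).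
  rewrite ler_wpM2r ?exprn_ge0 // cabsM mulrC.
  have -> : (k`!%:R)^-1 = ((k`!%:R)^-1)%:C :> R[i] by rewrite fmorphV rmorph_nat.
  rewrite cabsC ger0_norm ?invr_ge0 // ler_wpM2r ?invr_ge0 //.
  exact: cabs_entry.
pose B := \matrix_(i, j) (psum (@complex.Re R \o e i j) 1 +i*
                          psum (@complex.Im R \o e i j) 1).
suff cB : series (fun k => (k`!%:R)^-1 *: A ^+ k) @ \oo --> B.
  by rewrite /expmx (cvg_lim _ cB).
apply: cvg_entries => i j; rewrite mxE.
have -> : (fun n => series (fun k => (k`!%:R)^-1 *: A ^+ k) n i j) =
    series (fun k => e i j k * (1 : R)%:C ^+ k).
  apply/funext => n; rewrite /series /= summxE; apply: eq_bigr => k _.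
  by rewrite mxE rmorph1 expr1n mulr1.
have n1 : `|1 : R| < 2 by rewrite normr1; lra.
apply/cvg_cseries; split => /=; apply: (@cvg_psum _ _ 2 (expR (2 * s%:R))) => //.
- move=> k; apply: le_trans (eK i j k); rewrite ler_wpM2r ?exprn_ge0 //.
  exact: Re_le_cabs.
- move=> k; apply: le_trans (eK i j k); rewrite ler_wpM2r ?exprn_ge0 //.
  exact: Im_le_cabs.
Qed.

Lemma cvg_ev (Phi : 'cV[R[i]]_N) (A_ : nat -> 'M[R[i]]_N) B :
  A_ @ \oo --> B -> ev Phi (A_ n) @[n --> \oo] --> ev Phi B.
Proof.
move=> AB; rewrite evE; under eq_fun do rewrite evE.
apply: cvg_sumr => i _; apply: cvg_sumr => j _.
apply: cvgMr_tmp; apply: cvgMl_tmp.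
exact: (@cvg_comp _ _ _ A_ (fun M => M i j) _ _ _ AB
  (@coord_continuous _ _ _ i j B)).
Qed.

End MatrixExponential.

Section Amplitude.
Variables (R : realType) (d n k deg : nat) (H : hamiltonian R d n).
Variable phi : 'I_n -> 'cV[R[i]]_d.
Hypotheses (Hloc : is_local k H) (Hdeg : (max_degree H <= deg)%N).
Hypothesis phi1 : forall i, l2norm (phi i) = 1.
Hypothesis deg1 : (1 <= deg)%N.
Local Notation S := (ham_terms H).
Local Notation tL := (loschmidt_time R deg).
Local Notation f_ := (moment H phi finset.set0 S).

Let T := \sum_(x in S) term_op H x.

Let dS0 : fintype.disjoint (mem (finset.set0 : {set {set 'I_n}})) (mem S).
Proof. by rewrite finset.disjoints_subset finset.sub0set. Qed.

Let opbound_T m : opbound (#|S| ^ m)%N%:R (T ^+ m).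
Proof.
have := opbound_words Hloc m (finset.sub0set S) (boot.fintype.subxx _) dS0.
by rewrite cards0 nb_words0 words_set0.
Qed.

Let scale_exp (c : R[i]) m : (c *: T) ^+ m = c ^+ m *: T ^+ m.
Proof.
elim: m => [|m IH]; first by rewrite !expr0 scale1r.
by rewrite !exprS IH -!mulmxE -scalemxAl -scalemxAr scalerA.
Qed.

Lemma cvg_amplitude (t : R) :
  series (fun m => f_ m * t%:C ^+ m) @ \oo --> loschmidt_amplitude H phi t.
Proof.
have TE : - ('i * t%:C) *: ham_mx H = t%:C *: T.
  rewrite /T /ham_mx !scaler_sumr; apply: eq_bigr => x _.
  by rewrite /term_op !scalerA; congr (_ *: _); ring.
rewrite /loschmidt_amplitude TE -/(ev _ _).
(* [cvg_expmx] takes a natural growth rate, so |t| is rounded up. *)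
have tTK m : opbound ((Num.bound `|t| * #|S|) ^ m)%N%:R ((t%:C *: T) ^+ m).
  rewrite scale_exp -rmorphXn; apply: le_opbound (opboundZ _ (opbound_T m)).
  rewrite cabsC normrX expnMn natrM ler_wpM2r // natrX lerXn2r ?nnegrE //.
  exact/ltW/archi_boundP.
rewrite (_ : series _ = fun m => ev (product_state phi)
  (series (fun k => (k`!%:R)^-1 *: (t%:C *: T) ^+ k) m)).
  exact: cvg_ev (cvg_expmx tTK).
apply/funext => m; rewrite /series /= ev_sum; apply: eq_bigr => j _.
by rewrite scale_exp !evZ /moment words_set0 mulrCA mulrC.
Qed.

Lemma cabs_moment_bound m : cabs (f_ m) * tL ^+ m <= expR (tL * #|S|%:R).
Proof.
have [tL0 _ _ _] := cluster_constants R deg1.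
apply: le_trans (exp_term_le #|S| m (ltW tL0)).
rewrite ler_wpM2r ?exprn_ge0 ?(ltW tL0) //.
have := cabs_moment_le Hloc phi1 m (finset.sub0set S) (boot.fintype.subxx _) dS0.
by rewrite cards0 nb_words0.
Qed.

(** Integrating t Z'/Z termwise divides its m-th coefficient by m, which cancels the factor m of its
    bound and leaves the number of terms, O(n). *)
Lemma log_amplitude_coefs : exists c : nat -> R[i],
  (forall m, cabs (c m) * tL ^+ m <= (n * deg.+1).+1%:R) /\
  forall g, is_log_branch tL (loschmidt_amplitude H phi) g ->
  forall t, `|t| < tL -> complex.Re (g t) = psum (@complex.Re R \o c) t /\
                         complex.Im (g t) = psum (@complex.Im R \o c) t.
Proof.
have [tL0 _ _ _] := cluster_constants R deg1.
have [L [LE LK]] := moment_dlog Hloc Hdeg phi1 deg1.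
(* The bound on L has right-hand side 0 at m = 0, so the division by m is harmless there. *)
have L0 : L 0%N = 0.
  apply: cabs_eq0; apply/eqP; rewrite eq_le cabs_ge0 andbT.
  by have := LK 0%N; rewrite expr0 mulr1 mul0r.
pose p m := L m / m%:R.
have pK m : cabs (p m) * tL ^+ m <= #|S|%:R.
  case: m => [|m]; first by rewrite /p L0 mul0r cabs0 mul0r.
  have := LK m.+1; rewrite /p cabsM.
  have -> : (m.+1%:R)^-1 = ((m.+1%:R)^-1)%:C :> R[i] by rewrite fmorphV rmorph_nat.
  rewrite cabsC ger0_norm ?invr_ge0 // mulrAC ler_pdivrMr ?ltr0n //.
  by rewrite [_%:R * _]mulrC.
exists p; split=> [m|g gb t tr].
  by apply: le_trans (pK m) _; rewrite ler_nat; exact: card_ham_terms Hdeg.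
apply: (@log_branch_psum R tL (expR (tL * #|S|%:R)) #|S|%:R
  (loschmidt_amplitude H phi) g f_ p) => //.
- exact: cabs_moment_bound.
- by rewrite /p L0 mul0r.
- move=> m; rewrite LE big_ord_recl /= L0 mul0r add0r; apply: eq_bigr => j _.
  by rewrite /bump /= add1n subSS /p [_%:R * _]mulrCA mulfV ?mulr1 // pnatr_eq0.
- by move=> s _; exact: cvg_amplitude.
Qed.

End Amplitude.

(** * Passage to the limit *)

Lemma psumZr (R : realType) (a : nat -> R) r K (x t : R) : 0 < r ->
  coef_bound a r K -> `|t| < r -> psum (fun m => a m * x) t = psum a t * x.
Proof.
move=> r0 aK tr; apply/cvg_lim => //.
rewrite (_ : pseries _ t = fun n => pseries a t n * x).
  by apply: cvgMr_tmp; exact: cvg_psum r0 aK tr.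
apply/funext => n; rewrite /pseries /series /= mulr_suml.
by apply: eq_bigr => i _; rewrite mulrAC.
Qed.

Lemma limit_analytic (R : realType) (c : nat -> nat -> R) (G : R -> R) r K t0 :
  0 < r -> (forall n, coef_bound (c n) r K) ->
  (forall t, `|t| < r -> psum (c n) t @[n --> \oo] --> G t) -> `|t0| < r ->
  exists b rho, 0 < rho /\
    forall s, `|s - t0| < rho -> pseries b (s - t0) @ \oo --> G s.
Proof.
move=> r0 cK cG tr; have [l lK lG] := psum_limit r0 cK cG.
have [b [rho [rho0 H]]] := psum_recenter r0 lK tr.
(* The second bound keeps s in the interval on which G is the sum of l. *)
exists b, (Num.min rho (r - `|t0|)); split; first by rewrite lt_min rho0 subr_gt0.
move=> s; rewrite lt_min => /andP[s1 s2]; rewrite -lG; first exact: H.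
by have := ler_normD (s - t0) t0; rewrite subrK; lra.
Qed.

Theorem corollary15 (R : realType) (d k deg : nat)
    (H : forall n : nat, hamiltonian R d n)
    (phi : forall n : nat, 'I_n -> 'cV[R[i]]_d)
    (G : R -> R[i]) :
  (1 <= deg)%N ->
  (forall n, is_local k (H n)) ->
  (forall n, (max_degree (H n) <= deg)%N) ->
  (forall n (i : 'I_n), l2norm (phi n i) = 1) ->
  let tL : R := loschmidt_time R deg in
  let g (n : nat) : R -> R[i] :=
    log_branch tL (loschmidt_amplitude (H n) (phi n)) in
  (forall t : R, `|t| < tL -> (fun n => g n t / n%:R) @ \oo --> G t) ->
  (forall t : R, `|t| < tL -> analytic_at G t) /\
  (forall t : R, dynamical_phase_transition G t -> tL <= `|t|).
Proof.
move=> deg1 Hloc Hdeg phi1 tL g gG.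
suff anG t : `|t| < tL -> analytic_at G t.
  by split=> // t tP; rewrite leNgt; apply/negP => /anG.
have [tL0 _ _ _] := cluster_constants R deg1.
have coefs n : exists c : nat -> R[i],
    (forall m, cabs (c m) * tL ^+ m <= (n * deg.+1).+1%:R) /\
    forall t, `|t| < tL -> complex.Re (g n t) = psum (@complex.Re R \o c) t /\
                           complex.Im (g n t) = psum (@complex.Im R \o c) t.
  have [c [cK cE]] := log_amplitude_coefs (Hloc n) (Hdeg n) (@phi1 n) deg1.
  have [[h hb]|nob] := pselect (exists h,
      is_log_branch tL (loschmidt_amplitude (H n) (phi n)) h).
    by exists c; split=> //; apply: cE; apply: (xgetPex _ (ex_intro _ h hb)).
  (* Without a branch, [log_branch] is the constant 0, represented by zero coefficients. *)
  exists (fun=> 0); split=> [m|s _]; first by rewrite cabs0 mul0r.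
  rewrite /g /log_branch xgetPN => [|h hb]; last by apply: nob; exists h.
  have psum_cst0 : psum (fun=> 0 : R) s = 0.
    apply/cvg_lim => //; rewrite (_ : pseries _ _ = fun=> 0); first exact: cvg_cst.
    by apply/funext => m; rewrite /pseries /series /= big1 // => i _; rewrite mul0r.
  by rewrite psum_cst0.
have [c cP] := boolp.choice coefs.
have scaled (P : R[i] -> R) n : (forall z, `|P z| <= cabs z) ->
    coef_bound (fun m => P (c n m) * n%:R^-1) tL deg.+2%:R.
  move=> Pc m; rewrite normrM [`|_^-1|]ger0_norm ?invr_ge0 // mulrAC.
  (* At n = 0 the inverse is 0; for n >= 1, n (deg + 1) + 1 <= n (deg + 2), whence the uniform bound
     deg + 2. *)
  case: n => [|n]; first by rewrite invr0 mulr0.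
  rewrite ler_pdivrMr ?ltr0n //; apply: le_trans (_ : cabs (c n.+1 m) * tL ^+ m <= _).
    by rewrite ler_wpM2r ?exprn_ge0 // ltW.
  by apply: le_trans ((cP n.+1).1 m) _; rewrite -natrM ler_nat; nia.
have bound (P : R[i] -> R) n : (forall z, `|P z| <= cabs z) ->
    coef_bound (P \o c n) tL (n * deg.+1).+1%:R.
  move=> Pc m; apply: le_trans ((cP n).1 m).
  by rewrite ler_wpM2r ?exprn_ge0 ?(ltW tL0) //; exact: Pc.
have natV n : (n%:R)^-1 = (n%:R^-1)%:C :> R[i] by rewrite fmorphV rmorph_nat.
move=> tr; apply: analytic_at_ReIm.
- apply: (@limit_analytic _ (fun n m => complex.Re (c n m) * n%:R^-1) _ tL deg.+2%:R)
    => // [n|s sr]; first exact: (scaled (@complex.Re R) n (@Re_le_cabs R)).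
  have /cvg_ReIm[gs _] := gG s sr.
  rewrite (_ : (fun n => _) = fun n => complex.Re (g n s / n%:R)) //.
  apply/funext => n.
  rewrite natV cReMr ((cP n).2 s sr).1.
  by rewrite (psumZr _ tL0 (bound _ n (@Re_le_cabs R)) sr).
apply: (@limit_analytic _ (fun n m => complex.Im (c n m) * n%:R^-1) _ tL deg.+2%:R)
  => // [n|s sr]; first exact: (scaled (@complex.Im R) n (@Im_le_cabs R)).
have /cvg_ReIm[_ gs] := gG s sr.
rewrite (_ : (fun n => _) = fun n => complex.Im (g n s / n%:R)) //.
apply/funext => n.
rewrite natV cImMr ((cP n).2 s sr).2.
by rewrite (psumZr _ tL0 (bound _ n (@Im_le_cabs R)) sr).
Qed.
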